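(* Let $W$ be an admissible mixing matrix and let every $f_{i,\ell}$ be $L$-smooth and bounded from below. Run D-RR for $T\ge1$ epochs with constant stepsize $\alpha_t=\alpha>0$. (i) If $\alpha\le\min\Big\{\frac{1-\lambda^2}{4mL\sqrt{14}},\ \Big[\frac{(1-\lambda^2)^2}{384m^2L^3T}\Big]^{1/3}\Big\}$, then $$\min_{0\le t\le T-1}\mathbb{E}\|\nabla f(\bar x_t^0)\|^2\le\frac{12(f(\bar x_0^0)-f^* )}{\alpha mT}+\frac{96L^2\|\mathbf{x}_0^0-\mathbf{1}(\bar x_0^0)^\top\|^2}{mn(1-\lambda^2)T}+\frac{984\alpha^2mL^3\sigma_f^*}{(1-\lambda^2)^2}.$$ (ii) If in addition $\alpha=\Big\{\frac{4\sqrt{14}\,mL}{1-\lambda^2}+\Big[\frac{384m^2L^3T}{(1-\lambda^2)^2}\Big]^{1/3}\Big\}^{-1}$, then $$\min_{0\le t\le T-1}\mathbb{E}\|\nabla f(\bar x_t^0)\|^2\le\frac{88L(f(\bar x_0^0)-f^* )+20L\sigma_f^*}{(1-\lambda^2)^{2/3}m^{1/3}T^{2/3}}+\frac{96L^2\|\mathbf{x}_0^0-\mathbf{1}(\bar x_0^0)^\top\|^2}{mn(1-\lambda^2)T}+\frac{48\sqrt{14}\,L(f(\bar x_0^0)-f^* )}{(1-\lambda^2)T}.$$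
   Context: Problem. $n$ agents, $m$ samples per agent, functions $f_{i,\ell}:\mathbb{R}^p\to\mathbb{R}$ ($1\le i\le n$, $1\le\ell\le m$), $f_i=\frac1m\sum_{\ell=1}^mf_{i,\ell}$, $f=\frac1n\sum_{i=1}^nf_i$. $L$-smooth ($L>0$) means $\|\nabla f_{i,\ell}(x)-\nabla f_{i,\ell}(x')\|\le L\|x-x'\|$ for all $x,x'$. $f^*=\inf f$, $f_{i,\ell}^*=\inf f_{i,\ell}$; $\sigma_f^*:=f^*-\frac1{mn}\sum_{i,\ell}f_{i,\ell}^*$. $\|\cdot\|$ is the Euclidean norm of vectors and Frobenius norm of $n\times p$ matrices. Admissible mixing matrix: $W=[w_{ij}]\in\mathbb{R}^{n\times n}$ is nonnegative, symmetric, $W\mathbf{1}=\mathbf{1}$, and compatible with a connected undirected graph on $\{1,\dots,n\}$ (with self-loops), i.e. for $i\ne j$, $w_{ij}=w_{ji}>0$ if $(i,j)$ is an edge and $0$ otherwise; $\lambda$ is the spectral norm of $W-\mathbf{1}\mathbf{1}^\top/n$, and $\lambda<1$. D-RR (Distributed Random Reshuffling). $\mathbf{x}_t^\ell\in\mathbb{R}^{n\times p}$ has rows $(x_{i,t}^\ell)^\top$, $\bar x_t^\ell=\frac1n\sum_ix_{i,t}^\ell$; $\mathbf{x}_0^0$ is deterministic. In each epoch $t=0,1,\dots$, each agent $i$ draws, independently across agents and epochs, a uniformly random permutation $(\pi_0^i,\dots,\pi_{m-1}^i)$ of $\{1,\dots,m\}$; for $\ell=0,\dots,m-1$: $x_{i,t}^{\ell+1}=\sum_jw_{ij}\big(x_{j,t}^\ell-\alpha\nabla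 f_{j,\pi_\ell^j}(x_{j,t}^\ell)\big)$; finally $x_{i,t+1}^0=x_{i,t}^m$. *)

(* Defs.v *)
From HB Require Import structures.
From mathcomp Require Import all_boot all_order all_algebra all_fingroup.
From mathcomp Require Import all_classical all_reals all_analysis.

Set Implicit Arguments.
Unset Strict Implicit.
Unset Printing Implicit Defensive.

Import Order.TTheory GRing.Theory Num.Theory.
Import numFieldNormedType.Exports.

Local Open Scope classical_set_scope.
Local Open Scope ring_scope.

(* The library norm on 'M[R]_(m, n) is the sup norm, hence this definition of *)
(* the Frobenius norm; on row and column vectors it is the Euclidean norm.    *)
Definition frobenius_norm (R : realType) (m n : nat) (A : 'M[R]_(m, n)) : R :=
  Num.sqrt (\sum_(i < m) \sum_(j < n) A i j ^+ 2).

Definition spectral_norm (R : realType) (m n : nat) (A : 'M[R]_(m, n)) : R :=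
  sup [set frobenius_norm (A *m v) | v in
        [set v : 'cV[R]_n | frobenius_norm v <= 1]].

Definition gradient (R : realType) (p : nat) (f : 'rV[R]_p -> R)
    (x : 'rV[R]_p) : 'rV[R]_p :=
  \row_(k < p) 'D_(delta_mx 0 k) f x.

Definition smooth (R : realType) (p : nat) (L : R) (f : 'rV[R]_p -> R) : Prop :=
  (forall x, differentiable f x) /\
  (forall x y, frobenius_norm (gradient f x - gradient f y)
               <= L * frobenius_norm (x - y)).

Definition inf_value (R : realType) (p : nat) (f : 'rV[R]_p -> R) : R :=
  inf (range f).

Section Objective.
Variables (R : realType) (n m p : nat).
Variable f : 'I_n -> 'I_m -> 'rV[R]_p -> R.

Definition local_objective (i : 'I_n) (x : 'rV[R]_p) : R :=
  m%:R^-1 * \sum_(l < m) f i l x.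

Definition objective (x : 'rV[R]_p) : R :=
  n%:R^-1 * \sum_(i < n) local_objective i x.

Definition sigma_star : R :=
  inf_value objective
  - (m%:R * n%:R)^-1 * \sum_(i < n) \sum_(l < m) inf_value (f i l).

End Objective.

Definition mixing_rate (R : realType) (n : nat) (W : 'M[R]_n) : R :=
  spectral_norm (W - n%:R^-1 *: (const_mx 1 : 'M[R]_n)).

(* The graph e carries self-loops, but the diagonal of W is only required to  *)
(* be nonnegative; the bound on the mixing rate is a genuine requirement,     *)
(* since W may otherwise be periodic.                                         *)
Definition admissible_mixing (R : realType) (n : nat) (W : 'M[R]_n) : Prop :=
  [/\ forall i j, 0 <= W i j,
      W^T = W,
      W *m const_mx 1 = const_mx 1 :> 'cV[R]_n,
      exists e : rel 'I_n,
        [/\ reflexive e, symmetric e, forall i j, connect e i j &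
            forall i j, i != j ->
              (e i j -> 0 < W i j) /\ (~~ e i j -> W i j = 0)] &
      mixing_rate W < 1].

Section DRR.
Variables (R : realType) (n m p : nat).
Variable f : 'I_n -> 'I_m -> 'rV[R]_p -> R.
Variables (W : 'M[R]_n) (alpha : R).

(* Row i of the n x p matrix x is the iterate held by agent i.                *)
Definition agent_mean (x : 'M[R]_(n, p)) : 'rV[R]_p :=
  n%:R^-1 *: \sum_(i < n) row i x.

Definition consensus_error (x : 'M[R]_(n, p)) : 'M[R]_(n, p) :=
  x - (const_mx 1 : 'cV[R]_n) *m agent_mean x.

Definition drr_step (pi : 'I_n -> 'S_m) (x : 'M[R]_(n, p)) (l : 'I_m) :
    'M[R]_(n, p) :=
  \matrix_(i < n)
    \sum_(j < n) W i j *: (row j x - alpha *: gradient (f j (pi j l)) (row j x)).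

Definition drr_epoch (pi : 'I_n -> 'S_m) (x : 'M[R]_(n, p)) : 'M[R]_(n, p) :=
  foldl (drr_step pi) x (enum 'I_m).

(* The state at the start of epoch t; pi t j is the permutation drawn by      *)
(* agent j in epoch t.                                                        *)
Fixpoint drr (x0 : 'M[R]_(n, p)) (pi : nat -> 'I_n -> 'S_m) (t : nat) :
    'M[R]_(n, p) :=
  if t is t'.+1 then drr_epoch (pi t') (drr x0 pi t') else x0.

End DRR.

Section Randomness.
Variables (d : measure_display) (Omega : measurableType d) (R : realType).
Variable P : probability Omega R.

Definition finite_random_variable (S : finType) (X : Omega -> S) : Prop :=
  forall s, measurable (X @^-1` [set s]).

Definition uniformly_distributed (S : finType) (X : Omega -> S) : Prop :=
  forall s, P (X @^-1` [set s]) = (#|S|%:R^-1)%:E.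

(* Every subset of S is an event, S being finite.                             *)
Definition mutually_independent (I : eqType) (S : finType)
    (X : I -> Omega -> S) : Prop :=
  forall (J : seq I) (A : I -> set S), uniq J ->
    P (\bigcap_(j in [set` J]) X j @^-1` A j)
    = (\prod_(j <- J) P (X j @^-1` A j))%E.

Definition random_reshuffling (n m : nat) (pi : nat -> 'I_n -> Omega -> 'S_m) :
    Prop :=
  [/\ forall t i, finite_random_variable (pi t i),
      forall t i, uniformly_distributed (pi t i) &
      mutually_independent (fun ti : nat * 'I_n => pi ti.1 ti.2)].

End Randomness.

(* Main.v *)
(* Fix an epoch starting at x with mean xbar.  Smoothness gives a descent
   inequality whose error is L^2 times the sum S over the epoch of the mean
   squared distances of the agents' iterates to xbar.  By Pythagoras this
   distance splits into the consensus error, which the mixing matrix contracts,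
   and the drift of the mean, which up to a multiple of S is the partial sum of
   the gradients sampled at xbar.  Since sampling without replacement is
   negatively correlated, the centred part of that partial sum has second moment
   at most m times the variance, and the latter is bounded through the function
   values by 2L (f(xbar) - f* + sigma).  Hence the potential f(xbar) - f* plus
   2 alpha L^2 / (1 - lambda^2) times the consensus error satisfies
   E q_(t+1) <= (1 + c) E q_t - (alpha m / 4) E |grad f|^2 + c sigma with
   c T <= 1/16, and telescoping with the weights (1 + c)^t concludes. *)
Require Import Defs.
From HB Require Import structures.
From mathcomp Require Import all_boot all_order all_algebra all_fingroup.
From mathcomp Require Import all_classical all_reals all_analysis.
From mathcomp Require Import ring lra.
Import Order.TTheory GRing.Theory Num.Theory.
Import numFieldNormedType.Exports.
Local Open Scope classical_set_scope.
Local Open Scope ring_scope.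

Set Implicit Arguments.
Unset Strict Implicit.
Unset Printing Implicit Defensive.

(** * Two quadratic inequalities for finite sums *)

(** Expand the nonnegative double sum of [(b i - b j) ^+ 2]. The predicate is absorbed by extending
    [a] by zero, so the factor is the size of the whole index type. *)
Lemma sqr_sum_le (R : realFieldType) (I : finType) (P : pred I) (a : I -> R) :
  (\sum_(i | P i) a i) ^+ 2 <= #|I|%:R * \sum_(i | P i) a i ^+ 2.
Proof.
rewrite big_mkcond [X in _ <= _ * X]big_mkcond /=.
set b := fun i => if P i then a i else 0.
rewrite (eq_bigr b) // [X in _ <= _ * X](eq_bigr (fun i => b i ^+ 2)); last first.
  by move=> i _; rewrite /b; case: ifP => _ //; rewrite expr0n.
have : 0 <= \sum_i \sum_j (b i - b j) ^+ 2.
  by apply: sumr_ge0 => i _; apply: sumr_ge0 => j _; exact: sqr_ge0.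
have -> : \sum_i \sum_j (b i - b j) ^+ 2 =
    2 * (#|I|%:R * \sum_i b i ^+ 2) - 2 * (\sum_i b i) ^+ 2.
  have e i j : (b i - b j) ^+ 2 = b i ^+ 2 - 2 * (b i * b j) + b j ^+ 2 by ring.
  under eq_bigr => i _ do (under eq_bigr => j _ do rewrite e).
  have cst (c : R) : \sum_(i : I) c = #|I|%:R * c by rewrite sumr_const mulr_natl.
  under eq_bigr => i _ do rewrite big_split sumrB /= cst -!mulr_sumr.
  rewrite big_split sumrB /= -(mulr_sumr _ _ _ #|I|%:R).
  by rewrite -mulr_sumr -mulr_suml cst; ring.
by lra.
Qed.

(** Lagrange's identity: the gap between the two sides is half a double sum of squares. *)
Lemma cauchy_schwarz_sum (R : realFieldType) (I : finType) (a b : I -> R) :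
  (\sum_i a i * b i) ^+ 2 <= (\sum_i a i ^+ 2) * (\sum_i b i ^+ 2).
Proof.
have : 0 <= \sum_i \sum_j (a i * b j - a j * b i) ^+ 2.
  by apply: sumr_ge0 => i _; apply: sumr_ge0 => j _; exact: sqr_ge0.
have -> : \sum_i \sum_j (a i * b j - a j * b i) ^+ 2 =
    2 * ((\sum_i a i ^+ 2) * (\sum_i b i ^+ 2)) - 2 * (\sum_i a i * b i) ^+ 2.
  have e i j : (a i * b j - a j * b i) ^+ 2 = a i ^+ 2 * b j ^+ 2
      - 2 * ((a i * b i) * (a j * b j)) + b i ^+ 2 * a j ^+ 2 by ring.
  under eq_bigr => i _ do (under eq_bigr => j _ do rewrite e).
  under eq_bigr => i _ do rewrite big_split sumrB /= -!mulr_sumr.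
  rewrite big_split sumrB /= -!mulr_sumr -!mulr_suml.
  by ring.
by lra.
Qed.

(** * Inner product and squared Frobenius norm *)

Definition dotr (R : realType) (p : nat) (u v : 'rV[R]_p) : R :=
  \sum_k u 0 k * v 0 k.

(** The square of [frobenius_norm], free of square roots, so that identities become polynomial. *)
Definition sqn (R : realType) (m n : nat) (A : 'M[R]_(m, n)) : R :=
  \sum_i \sum_j A i j ^+ 2.

Section SquaredNorm.
Variable R : realType.
Implicit Types m n p : nat.

Lemma sqn_ge0 m n (A : 'M[R]_(m, n)) : 0 <= sqn A.
Proof. by apply: sumr_ge0 => i _; apply: sumr_ge0 => j _; exact: sqr_ge0. Qed.

Lemma frobenius_norm_sqr m n (A : 'M[R]_(m, n)) : frobenius_norm A ^+ 2 = sqn A.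
Proof. by rewrite sqr_sqrtr //; exact: sqn_ge0. Qed.

Lemma sqn_rows m n (A : 'M[R]_(m, n)) : sqn A = \sum_i sqn (row i A).
Proof.
apply: eq_bigr => i _; rewrite /sqn big_ord1.
by apply: eq_bigr => j _; rewrite mxE.
Qed.

Lemma sqn_cols m n (A : 'M[R]_(m, n)) : sqn A = \sum_j sqn (col j A).
Proof.
rewrite /sqn exchange_big; apply: eq_bigr => j _.
by apply: eq_bigr => i _; rewrite big_ord1 mxE.
Qed.

Lemma sqn_row p (u : 'rV[R]_p) : sqn u = \sum_k u 0 k ^+ 2.
Proof. by rewrite /sqn big_ord1. Qed.

Lemma sqnZ m n c (A : 'M[R]_(m, n)) : sqn (c *: A) = c ^+ 2 * sqn A.
Proof.
rewrite /sqn mulr_sumr; apply: eq_bigr => i _; rewrite mulr_sumr.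
by apply: eq_bigr => j _; rewrite mxE exprMn.
Qed.

Lemma sqnN m n (A : 'M[R]_(m, n)) : sqn (- A) = sqn A.
Proof. by rewrite -scaleN1r sqnZ sqrrN expr1n mul1r. Qed.

Lemma sqn0 m n : sqn (0 : 'M[R]_(m, n)) = 0.
Proof. by rewrite -(scale0r 0) sqnZ expr0n mul0r. Qed.

Lemma sqn_le_lin m n a b (A B D : 'M[R]_(m, n)) :
  (forall i j, D i j ^+ 2 <= a * A i j ^+ 2 + b * B i j ^+ 2) ->
  sqn D <= a * sqn A + b * sqn B.
Proof.
move=> le; rewrite /sqn !mulr_sumr -big_split /=; apply: ler_sum => i _.
by rewrite !mulr_sumr -big_split /=; apply: ler_sum => j _.
Qed.

Lemma sqnD_le m n (A B : 'M[R]_(m, n)) : sqn (A + B) <= 2 * sqn A + 2 * sqn B.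
Proof.
apply: sqn_le_lin => i j; rewrite mxE.
by have := sqr_ge0 (A i j - B i j); rewrite sqrrB sqrrD; lra.
Qed.

Lemma sqn_sum_le m n (I : finType) (P : pred I) (A : I -> 'M[R]_(m, n)) :
  sqn (\sum_(i | P i) A i) <= #|I|%:R * \sum_(i | P i) sqn (A i).
Proof.
rewrite /sqn [X in _ <= _ * X]exchange_big mulr_sumr /=; apply: ler_sum => k _.
rewrite [X in _ <= _ * X]exchange_big mulr_sumr; apply: ler_sum => j _.
by rewrite summxE; exact: sqr_sum_le.
Qed.

Lemma dotrDl p (u v w : 'rV[R]_p) : dotr (u + v) w = dotr u w + dotr v w.
Proof. by rewrite -big_split; apply: eq_bigr => k _; rewrite mxE mulrDl. Qed.

Lemma dotrC p (u v : 'rV[R]_p) : dotr u v = dotr v u.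
Proof. by apply: eq_bigr => k _; rewrite mulrC. Qed.

Lemma dotrZl p c (u v : 'rV[R]_p) : dotr (c *: u) v = c * dotr u v.
Proof. by rewrite mulr_sumr; apply: eq_bigr => k _; rewrite mxE mulrA. Qed.

Lemma dotrZr p c (u v : 'rV[R]_p) : dotr u (c *: v) = c * dotr u v.
Proof. by rewrite dotrC dotrZl dotrC. Qed.

Lemma dotrBl p (u v w : 'rV[R]_p) : dotr (u - v) w = dotr u w - dotr v w.
Proof. by rewrite dotrDl -scaleN1r dotrZl mulN1r. Qed.

Lemma dotr0l p (v : 'rV[R]_p) : dotr 0 v = 0.
Proof. by rewrite -(scale0r 0) dotrZl mul0r. Qed.

Lemma dotr_suml p (I : Type) (s : seq I) (P : pred I) (u : I -> 'rV[R]_p) v :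
  dotr (\sum_(i <- s | P i) u i) v = \sum_(i <- s | P i) dotr (u i) v.
Proof.
by elim/big_rec2: _ => [|i _ x _ <-]; rewrite ?dotr0l // dotrDl.
Qed.

Lemma dotr_sumr p (I : Type) (s : seq I) (P : pred I) (u : I -> 'rV[R]_p) v :
  dotr v (\sum_(i <- s | P i) u i) = \sum_(i <- s | P i) dotr v (u i).
Proof. by rewrite dotrC dotr_suml; apply: eq_bigr => i _; rewrite dotrC. Qed.

Lemma dotrr p (u : 'rV[R]_p) : dotr u u = sqn u.
Proof. by rewrite sqn_row; apply: eq_bigr => k _; rewrite expr2. Qed.

Lemma sqnD p (u v : 'rV[R]_p) : sqn (u + v) = sqn u + 2 * dotr u v + sqn v.
Proof. by rewrite -!dotrr dotrDl !(dotrC _ (u + v)) !dotrDl (dotrC v u); ring. Qed.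

Lemma sqnB p (u v : 'rV[R]_p) : sqn (u - v) = sqn u - 2 * dotr u v + sqn v.
Proof. by rewrite sqnD sqnN -scaleN1r dotrZr; ring. Qed.

Lemma dotr_le p (u v : 'rV[R]_p) :
  dotr u v <= frobenius_norm u * frobenius_norm v.
Proof.
apply: le_trans (ler_norm _) _.
rewrite -(@ler_pXn2r _ 2) ?nnegrE ?mulr_ge0 ?sqrtr_ge0 //.
rewrite real_normK ?num_real // exprMn !frobenius_norm_sqr !sqn_row.
exact: cauchy_schwarz_sum.
Qed.

End SquaredNorm.

(** * Smooth functions: quadratic upper bound and gradient bound *)

Section Gradient.
Variables (R : realType) (p : nat).
Implicit Types (g : 'rV[R]_p -> R) (x y d : 'rV[R]_p).

(** Differentiability makes the directional derivative linear in [d], so the partial derivatives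
    collected in [gradient] determine it. *)
Lemma derive_gradient g x d : differentiable g x -> 'D_d g x = dotr (gradient g x) d.
Proof.
move=> dg; rewrite deriveE // {1}(row_sum_delta d) linear_sum /=.
by apply: eq_bigr => k _; rewrite linearZ /= mxE deriveE // mulrC.
Qed.

Lemma is_derive_line g x d (t : R) : differentiable g (x + t *: d) ->
  is_derive t 1 (fun s : R => g (x + s *: d)) (dotr (gradient g (x + t *: d)) d).
Proof.
move=> dg; rewrite -derive_gradient //.
have e : (fun h : R => h^-1 *: (((fun s : R => g (x + s *: d)) \o shift t) (h *: 1)
            - g (x + t *: d))) =
         (fun h : R => h^-1 *: ((g \o shift (x + t *: d)) (h *: d)
            - g (x + t *: d))).
  apply/funext => h /=; congr (_ *: (g _ - _)).
  by rewrite [h *: 1]mulr1 scalerDl addrCA.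
split; last by rewrite /derive e.
by rewrite /derivable e; apply: diff_derivable.
Qed.

(** Along the segment, [g] minus its quadratic model has nonpositive derivative, by Cauchy-Schwarz
    and the Lipschitz gradient; the mean value theorem then compares the endpoints. *)
Lemma smooth_upper_bound g (L : R) x d : smooth L g ->
  g (x + d) <= g x + dotr (gradient g x) d + L / 2 * sqn d.
Proof.
move=> [dg lg].
pose psi (t : R) := g (x + t *: d) - (t * dotr (gradient g x) d + L / 2 * sqn d * t ^+ 2).
pose dpsi (t : R) := dotr (gradient g (x + t *: d)) d
  - (dotr (gradient g x) d + L * sqn d * t).
have D (t : R) : is_derive t 1 psi (dpsi t).
  have line := is_derive_line (dg (x + t *: d)).
  apply: is_deriveB.
  apply: is_derive_eq.
  by rewrite /GRing.scale /=; lra.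
have [|c c01] := @MVT_segment R psi dpsi 0 1 ler01 (fun t _ => D t).
  by apply: derivable_within_continuous => t _; apply: ex_derive; exact: D.
rewrite subr0 mulr1 {1 2}/psi scale1r scale0r addr0 => e.
suff : dpsi c <= 0 by move: e; rewrite expr1n expr0n /=; lra.
have /andP[c0 _] : 0 <= c <= 1 by move: c01; rewrite in_itv.
rewrite /dpsi opprD addrA -dotrBl subr_le0 (le_trans (dotr_le _ _)) //.
apply: (@le_trans _ _ (L * frobenius_norm (c *: d) * frobenius_norm d)).
  apply: ler_wpM2r; first exact: sqrtr_ge0.
  by have := lg (x + c *: d) x; rewrite [x + _ - x]addrAC subrr add0r.
rewrite -frobenius_norm_sqr {1}/frobenius_norm -/(sqn _) sqnZ sqrtrM ?sqr_ge0 //.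
by rewrite sqrtr_sqr ger0_norm // /frobenius_norm -/(sqn d); lra.
Qed.

(** A gradient step of length [L^-1] lowers [g] by at least [(2 * L)^-1 * sqn (gradient g x)], yet
    cannot go below the infimum. *)
Lemma smooth_gradient_le g (L : R) x : 0 < L -> smooth L g ->
  has_lbound (range g) -> sqn (gradient g x) <= 2 * L * (g x - inf_value g).
Proof.
move=> L0 sg lb; have := smooth_upper_bound x (- L^-1 *: gradient g x) sg.
have : inf_value g <= g (x + - L^-1 *: gradient g x).
  by apply: ge_inf => //; exists (x + - L^-1 *: gradient g x).
set y := g _; rewrite dotrZr dotrr sqnZ sqrrN.
move=> h1 h2; have {h1 h2} := le_trans h1 h2.
have -> : g x + - L^-1 * sqn (gradient g x) + L / 2 * (L^-1 ^+ 2 * sqn (gradient g x))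
   = g x - (2 * L)^-1 * sqn (gradient g x) by field; rewrite gt_eqF.
by rewrite lerBrDr addrC -lerBrDr ler_pdivrMl ?mulr_gt0.
Qed.

Lemma smooth_sqn_le g (L : R) x y : 0 < L -> smooth L g ->
  sqn (gradient g x - gradient g y) <= L ^+ 2 * sqn (x - y).
Proof.
move=> L0 [_ lg]; rewrite -!frobenius_norm_sqr -exprMn.
by rewrite ler_pXn2r ?nnegrE ?mulr_ge0 ?sqrtr_ge0 // ltW.
Qed.

End Gradient.

(** * The finite-sum objective *)

Lemma is_derive_scaled_sum (R : realType) (V : normedModType R) (N : nat)
    (h : 'I_N -> V -> R) (dh : 'I_N -> R) (c : R) (x v : V) :
  (forall i, is_derive x v (h i) (dh i)) ->
  is_derive x v (fun y => c * \sum_i h i y) (c * \sum_i dh i).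
Proof.
move=> D; have := is_deriveZ c (is_derive_sum D).
by rewrite (_ : c \*: _ = fun y => c * \sum_i h i y) //; apply/funext => y /=; rewrite fct_sumE.
Qed.

Section Objective.
Variables (R : realType) (n m p : nat) (f : 'I_n -> 'I_m -> 'rV[R]_p -> R).
Hypotheses (n0 : (0 < n)%N) (m0 : (0 < m)%N).
Variable L : R.
Hypotheses (L0 : 0 < L) (fs : forall i l, smooth L (f i l)).
Hypothesis fb : forall i l, has_lbound (range (f i l)).

Let n1 : n%:R != 0 :> R. Proof. by rewrite pnatr_eq0 -lt0n. Qed.
Let m1 : m%:R != 0 :> R. Proof. by rewrite pnatr_eq0 -lt0n. Qed.

(** Merging the averages over agents and samples lets linearity and monotonicity be proved once for
    both. *)
Definition samples_mean (v : 'I_n -> 'I_m -> R) : R :=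
  (m%:R * n%:R)^-1 * \sum_i \sum_l v i l.

Lemma samples_meanE v : samples_mean v = n%:R^-1 * \sum_i m%:R^-1 * \sum_l v i l.
Proof.
by rewrite /samples_mean invfM (mulrC m%:R^-1) -mulrA; congr (_ * _); rewrite mulr_sumr.
Qed.

Lemma samples_mean_le u v : (forall i l, u i l <= v i l) -> samples_mean u <= samples_mean v.
Proof.
move=> uv; rewrite ler_wpM2l ?invr_ge0 ?mulr_ge0 //.
by apply: ler_sum => i _; apply: ler_sum => l _.
Qed.

Lemma samples_meanD u v :
  samples_mean (fun i l => u i l + v i l) = samples_mean u + samples_mean v.
Proof.
rewrite /samples_mean -mulrDr -big_split; congr (_ * _).
by apply: eq_bigr => i _; rewrite big_split.
Qed.

Lemma samples_meanZ c v : samples_mean (fun i l => c * v i l) = c * samples_mean v.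
Proof.
rewrite /samples_mean mulrCA; congr (_ * _).
by rewrite mulr_sumr; apply: eq_bigr => i _; rewrite mulr_sumr.
Qed.

Lemma samples_mean_cst c : samples_mean (fun _ _ => c) = c.
Proof.
rewrite /samples_mean; under eq_bigr do rewrite sumr_const card_ord.
by rewrite sumr_const card_ord -mulrnA -[c *+ _]mulr_natl natrM; field; rewrite n1 m1.
Qed.

Lemma objectiveE x : objective f x = samples_mean (fun i l => f i l x).
Proof. by rewrite samples_meanE. Qed.

Lemma objective_gradient x :
  gradient (objective f) x = n%:R^-1 *: \sum_i m%:R^-1 *: \sum_l gradient (f i l) x.
Proof.
apply/rowP => k; rewrite !mxE summxE.
have D i l : is_derive x (delta_mx 0 k) (f i l) (gradient (f i l) x 0 k).
  by rewrite mxE; split => //; apply: diff_derivable; case: (fs i l).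
have [_ ->] := is_derive_scaled_sum n%:R^-1
  (fun i => is_derive_scaled_sum m%:R^-1 (D i)).
by congr (_ * _); apply: eq_bigr => i _; rewrite mxE summxE.
Qed.

Lemma objective_gradient_dotr x d :
  dotr (gradient (objective f) x) d = samples_mean (fun i l => dotr (gradient (f i l) x) d).
Proof.
rewrite objective_gradient dotrZl dotr_suml samples_meanE; congr (_ * _).
by apply: eq_bigr => i _; rewrite dotrZl dotr_suml.
Qed.

Lemma objective_upper_bound x d :
  objective f (x + d) <= objective f x + dotr (gradient (objective f) x) d + L / 2 * sqn d.
Proof.
rewrite !objectiveE objective_gradient_dotr -(samples_mean_cst (L / 2 * sqn d)) -!samples_meanD.
by apply: samples_mean_le => i l; exact: smooth_upper_bound.
Qed.

Lemma objective_lbound : lbound (range (objective f)) (samples_mean (fun i l => inf_value (f i l))).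
Proof.
move=> _ [x _ <-]; rewrite objectiveE; apply: samples_mean_le => i l.
by apply: ge_inf => //; exists x.
Qed.

Lemma inf_objective_le x : inf_value (objective f) <= objective f x.
Proof.
apply: ge_inf; last by exists x.
by exists (samples_mean (fun i l => inf_value (f i l))); exact: objective_lbound.
Qed.

(** The infimum of an average is at least the average of the infima. *)
Lemma sigma_star_ge0 : 0 <= sigma_star f.
Proof.
rewrite subr_ge0; apply: lb_le_inf; first by exists (objective f 0); exists 0.
exact: objective_lbound.
Qed.

(** Average the gradient bound of each sample; the averaged infima equal [f* - sigma] by the
    definition of [sigma_star]. *)
Lemma gradient_second_moment x :
  samples_mean (fun i l => sqn (gradient (f i l) x))
  <= 2 * L * (objective f x - inf_value (objective f) + sigma_star f).
Proof.
apply: (@le_trans _ _ (samples_mean (fun i l => 2 * L * (f i l x + - 1 * inf_value (f i l))))).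
  apply: samples_mean_le => i l; rewrite mulN1r; exact: smooth_gradient_le.
rewrite samples_meanZ samples_meanD samples_meanZ -objectiveE /sigma_star.
by rewrite -/(samples_mean (fun i l => inf_value (f i l))); lra.
Qed.

End Objective.

(** * The spectral norm as an operator bound *)

Section SpectralNorm.
Variables (R : realType) (m n : nat) (A : 'M[R]_(m, n)).

(** A crude bound whose main use is to show that the set defining the spectral norm is bounded
    above, so that its [sup] is meaningful. *)
Lemma sqn_mulmx_frobenius p (B : 'M[R]_(n, p)) : sqn (A *m B) <= sqn A * sqn B.
Proof.
rewrite (sqn_cols B) /sqn mulr_suml; apply: ler_sum => i _.
rewrite mulr_sumr; apply: ler_sum => j _; rewrite mxE.
rewrite [X in _ * X](eq_bigr (fun k => B k j ^+ 2)); last by move=> k _; rewrite big_ord1 mxE.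
exact: cauchy_schwarz_sum.
Qed.

Let image_unit_ball := [set frobenius_norm (A *m v) | v in
  [set v : 'cV[R]_n | frobenius_norm v <= 1]].

Lemma frobenius_mulmx_le_spectral (v : 'cV[R]_n) :
  frobenius_norm v <= 1 -> frobenius_norm (A *m v) <= spectral_norm A.
Proof.
move=> v1; apply: (@ub_le_sup _ image_unit_ball); last by exists v.
exists (frobenius_norm A) => _ [u u1 <-].
rewrite -(@ler_pXn2r _ 2) ?nnegrE ?sqrtr_ge0 // !frobenius_norm_sqr.
apply: le_trans (sqn_mulmx_frobenius _) _.
rewrite ler_piMr ?sqn_ge0 // -frobenius_norm_sqr.
by rewrite expr_le1 // sqrtr_ge0.
Qed.

Lemma spectral_norm_ge0 : 0 <= spectral_norm A.
Proof.
apply: le_trans (frobenius_mulmx_le_spectral (v := 0) _); first exact: sqrtr_ge0.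
by rewrite /frobenius_norm -/(sqn _) sqn0 sqrtr0.
Qed.

(** By homogeneity it suffices to rescale [v] to the unit sphere; vectors of norm zero are treated
    apart. *)
Lemma sqn_mulmx_col_le (v : 'cV[R]_n) : sqn (A *m v) <= spectral_norm A ^+ 2 * sqn v.
Proof.
have [v0|v0] := eqVneq (sqn v) 0.
  by apply: le_trans (sqn_mulmx_frobenius _) _; rewrite v0 !mulr0.
have vpos : 0 < sqn v by rewrite lt_def v0 sqn_ge0.
have fpos : 0 < frobenius_norm v by rewrite sqrtr_gt0.
have := @frobenius_mulmx_le_spectral ((frobenius_norm v)^-1 *: v).
rewrite -scalemxAr -!(@ler_pXn2r _ 2 _ (frobenius_norm _)) ?nnegrE ?sqrtr_ge0 ?spectral_norm_ge0 //.
rewrite !frobenius_norm_sqr !sqnZ exprVn frobenius_norm_sqr expr1n mulVf // => /(_ (lexx _)).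
by rewrite ler_pdivrMl // mulrC.
Qed.

Lemma sqn_mulmx_le p (B : 'M[R]_(n, p)) : sqn (A *m B) <= spectral_norm A ^+ 2 * sqn B.
Proof.
rewrite !sqn_cols mulr_sumr; apply: ler_sum => j _.
by rewrite colE -mulmxA -colE; exact: sqn_mulmx_col_le.
Qed.

End SpectralNorm.

(** * Consensus error and its contraction by the mixing matrix *)

Section Consensus.
Variables (R : realType) (n p : nat).
Hypothesis n0 : (0 < n)%N.
Implicit Types (x y : 'M[R]_(n, p)) (v : 'rV[R]_p).

Let n1 : n%:R != 0 :> R. Proof. by rewrite pnatr_eq0 -lt0n. Qed.

Let J : 'M[R]_n := n%:R^-1 *: const_mx 1.

Definition deviation v x : R := n%:R^-1 * \sum_j sqn (row j x - v).

(** Written as a left product, the mean inherits linearity and its interplay with [W] from matrix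
    algebra. *)
Lemma agent_mean_mulmx x : agent_mean x = (n%:R^-1 *: const_mx 1 : 'rV_n) *m x.
Proof.
apply/rowP => k; rewrite !mxE summxE mulr_sumr; apply: eq_bigr => j _.
by rewrite !mxE mulr1.
Qed.

Lemma agent_meanD x y : agent_mean (x + y) = agent_mean x + agent_mean y.
Proof. by rewrite !agent_mean_mulmx mulmxDr. Qed.

Lemma agent_meanZ c x : agent_mean (c *: x) = c *: agent_mean x.
Proof. by rewrite !agent_mean_mulmx scalemxAr. Qed.

Lemma sqn_agent_mean_le x : sqn (agent_mean x) <= n%:R^-1 * sqn x.
Proof.
rewrite /agent_mean sqnZ expr2 -mulrA ler_pM2l ?invr_gt0 ?ltr0n //.
rewrite mulrC ler_pdivrMr ?ltr0n // mulrC (sqn_rows x).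
by apply: le_trans (sqn_sum_le _ _) _; rewrite card_ord.
Qed.

Lemma const_agent_mean x : const_mx 1 *m agent_mean x = J *m x.
Proof.
rewrite agent_mean_mulmx mulmxA; congr (_ *m _); apply/matrixP => i j.
by rewrite !mxE big_ord1 !mxE mul1r.
Qed.

Lemma row_consensus_error j x : row j (consensus_error x) = row j x - agent_mean x.
Proof.
apply/rowP => k; rewrite !mxE; congr (_ - _).
by rewrite big_ord1 !mxE mul1r.
Qed.

(** Pythagoras: the rows of the consensus error sum to zero, so the cross term vanishes. *)
Lemma deviationE v x :
  deviation v x = sqn (agent_mean x - v) + n%:R^-1 * sqn (consensus_error x).
Proof.
have e j : sqn (row j x - v) = sqn (row j (consensus_error x))
    + 2 * dotr (row j (consensus_error x)) (agent_mean x - v) + sqn (agent_mean x - v).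
  by rewrite -sqnD row_consensus_error addrA subrK.
rewrite /deviation; under eq_bigr do rewrite e.
rewrite !big_split /= -sqn_rows -mulr_sumr -dotr_suml sumr_const card_ord.
have -> : \sum_j row j (consensus_error x) = 0.
  under eq_bigr do rewrite row_consensus_error.
  rewrite sumrB sumr_const card_ord /agent_mean -scaler_nat scalerA divff //.
  by rewrite scale1r subrr.
by rewrite dotr0l mulr0 addr0 -mulr_natl; field.
Qed.

Variable W : 'M[R]_n.
Hypothesis aW : admissible_mixing W.

Let r := mixing_rate W ^+ 2.

Lemma mixing_rate_sqr_ge0_lt1 : 0 <= r < 1.
Proof.
rewrite sqr_ge0 /= /r; case: aW => _ _ _ _ l1.
by rewrite expr_lt1 // spectral_norm_ge0.
Qed.

(** By symmetry the columns of [W] also sum to one. *)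
Lemma mean_mixing x : agent_mean (W *m x) = agent_mean x.
Proof.
case: aW => _ Wt W1 _ _; rewrite !agent_mean_mulmx mulmxA; congr (_ *m _).
rewrite -scalemxAl; congr (_ *: _); apply: trmx_inj.
by rewrite trmx_mul Wt trmx_const W1.
Qed.

Lemma consensus_error_mixing x : consensus_error (W *m x) = (W - J) *m x.
Proof. by rewrite /consensus_error mean_mixing mulmxBl const_agent_mean. Qed.

(** Both [W] and [J] fix the all-ones vector, so [W - J] kills the mean part and contracts only the
    disagreement. *)
Lemma mixing_consensus_error x : (W - J) *m consensus_error x = (W - J) *m x.
Proof.
rewrite /consensus_error mulmxBr.
have -> : (W - J) *m (const_mx 1 *m agent_mean x) = 0.
  case: aW => _ _ W1 _ _; rewrite mulmxA mulmxBl W1.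
  have -> : J *m const_mx 1 = const_mx 1 :> 'cV_n.
    apply/colP => i; rewrite !mxE.
    under eq_bigr do rewrite !mxE !mulr1.
    by rewrite sumr_const card_ord -[_ *+ _]mulr_natl mulfV.
  by rewrite subrr mul0mx.
by rewrite subr0.
Qed.

(* Young's inequality with weight chosen so that the contraction factor
   lambda^2 degrades only to (1 + lambda^2) / 2. *)
Lemma consensus_error_step c x y :
  sqn (consensus_error (W *m (x - c *: y))) <=
  (1 + r) / 2 * sqn (consensus_error x) + 2 / (1 - r) * (c ^+ 2 * sqn y).
Proof.
have /andP[r0 r1] := mixing_rate_sqr_ge0_lt1.
have -> : consensus_error (W *m (x - c *: y)) = (W - J) *m (consensus_error x - c *: y).
  by rewrite consensus_error_mixing mulmxBr [RHS]mulmxBr mixing_consensus_error.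
apply: le_trans (sqn_mulmx_le _ _) _; rewrite -/(mixing_rate W) -!sqnZ.
move: (consensus_error x) => z.
apply: sqn_le_lin => i j; rewrite !mxE exprMn -/r -subr_ge0.
set a := z i j; set b := c * y i j.
have -> : (1 + r) / 2 * a ^+ 2 + 2 / (1 - r) * b ^+ 2 - r * (a - b) ^+ 2 =
    (1 - r) / 2 * (a + 2 * r / (1 - r) * b) ^+ 2 + (2 + r) * b ^+ 2.
  by field; rewrite subr_eq0 eq_sym lt_eqF.
by rewrite addr_ge0 // mulr_ge0 ?sqr_ge0 //; lra.
Qed.

End Consensus.

(** * One epoch with fixed permutations *)

Section Epoch.
Variables (R : realType) (n m p : nat) (f : 'I_n -> 'I_m -> 'rV[R]_p -> R).
Hypotheses (n0 : (0 < n)%N) (m0 : (0 < m)%N).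
Variable L : R.
Hypotheses (L0 : 0 < L) (fs : forall i l, smooth L (f i l)).
Variables (W : 'M[R]_n) (alpha : R).
Hypotheses (aW : admissible_mixing W) (alpha0 : 0 < alpha).

Let n1 : n%:R != 0 :> R. Proof. by rewrite pnatr_eq0 -lt0n. Qed.
Let m1 : m%:R != 0 :> R. Proof. by rewrite pnatr_eq0 -lt0n. Qed.
Let npos : 0 < n%:R :> R. Proof. by rewrite ltr0n. Qed.
Let mpos : 0 < m%:R :> R. Proof. by rewrite ltr0n. Qed.

Let r := mixing_rate W ^+ 2.

Definition second_moment (v : 'rV[R]_p) : R :=
  samples_mean (fun i l => sqn (gradient (f i l) v)).

Variables (x : 'M[R]_(n, p)) (pi : 'I_n -> 'S_m).

(** The epoch stopped after [k] steps. Folding over a prefix of the enumeration allows a natural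
    number [k] and gives the whole epoch at [k = m]. *)
Definition inner_iterate (k : nat) : 'M[R]_(n, p) :=
  foldl (drr_step f W alpha pi) x (take k (enum 'I_m)).

Let xbar := agent_mean x.
Let grad := gradient (objective f) xbar.

Definition sampled_gradients (l : 'I_m) : 'M[R]_(n, p) :=
  \matrix_(j < n) gradient (f j (pi j l)) (row j (inner_iterate l)).

(** The same samples as in [sampled_gradients], all evaluated at one point [v]: passing to them
    costs only the deviation from [v], and their sums depend on the permutations alone. *)
Definition frozen_gradients (v : 'rV[R]_p) (l : 'I_m) : 'M[R]_(n, p) :=
  \matrix_(j < n) gradient (f j (pi j l)) v.

Lemma inner_iterate0 : inner_iterate 0 = x.
Proof. by rewrite /inner_iterate take0. Qed.

Lemma inner_iterate_epoch : inner_iterate m = drr_epoch f W alpha pi x.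
Proof. by rewrite /inner_iterate take_oversize // size_enum_ord. Qed.

Lemma inner_iterateS (l : 'I_m) : inner_iterate l.+1 =
  W *m (inner_iterate l - alpha *: sampled_gradients l).
Proof.
rewrite /inner_iterate (take_nth l) ?size_enum_ord // -cats1 foldl_cat /= nth_ord_enum.
rewrite -/(inner_iterate l); apply/row_matrixP => i; rewrite rowK row_mul mulmx_sum_row.
apply: eq_bigr => j _; rewrite mxE; congr (_ *: _); apply/rowP => k.
by rewrite !mxE.
Qed.

(** Mixing preserves the mean, so the mean moves only by the averaged sampled gradients. *)
Lemma mean_inner_iterate k : (k <= m)%N -> agent_mean (inner_iterate k) =
  xbar - alpha *: \sum_(l < m | (l < k)%N) agent_mean (sampled_gradients l).
Proof.
elim: k => [_|k IH km]; first by rewrite inner_iterate0 big_pred0 // scaler0 subr0.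
rewrite -[k.+1]/((Ordinal km).+1) inner_iterateS mean_mixing // agent_meanD.
rewrite -scaleN1r !agent_meanZ scaleN1r IH ?(ltnW km) //= -addrA -opprD -scalerDr.
congr (_ - _ *: _); rewrite [RHS](bigD1 (Ordinal km)) //= addrC; congr (_ + _).
by apply: eq_bigl => l; rewrite -val_eqE /= ltnS andbC -ltn_neqAle.
Qed.

Let dev l := deviation xbar (inner_iterate l).
Let S := \sum_(l < m) dev l.

Lemma deviation_ge0 v (y : 'M[R]_(n, p)) : 0 <= deviation v y.
Proof. by rewrite mulr_ge0 ?invr_ge0 // sumr_ge0 // => j _; exact: sqn_ge0. Qed.

Lemma sampled_frozen_le (l : 'I_m) :
  n%:R^-1 * sqn (sampled_gradients l - frozen_gradients xbar l) <= L ^+ 2 * dev l.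
Proof.
rewrite /dev /deviation mulrCA ler_pM2l ?invr_gt0 // sqn_rows mulr_sumr.
by apply: ler_sum => j _; rewrite linearB /= !rowK; exact: smooth_sqn_le.
Qed.

Lemma sampled_frozen_mean_le (l : 'I_m) :
  sqn (agent_mean (sampled_gradients l - frozen_gradients xbar l)) <= L ^+ 2 * dev l.
Proof. by apply: le_trans (sqn_agent_mean_le _ _) (sampled_frozen_le l). Qed.

(* Each agent visits all its samples exactly once in an epoch. *)
Lemma frozen_gradients_sum v :
  \sum_l agent_mean (frozen_gradients v l) = m%:R *: gradient (objective f) v.
Proof.
rewrite (objective_gradient fs) /agent_mean -[LHS]scaler_sumr [in LHS]exchange_big /=.
rewrite [RHS]scalerA mulrC -[RHS]scalerA.
congr (_ *: _); rewrite scaler_sumr; apply: eq_bigr => j _.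
rewrite scalerA divff // scale1r [RHS](reindex_perm (pi j)).
by apply: eq_bigr => l _; rewrite rowK.
Qed.

Lemma frozen_gradients_sqn v :
  \sum_l sqn (frozen_gradients v l) = m%:R * n%:R * second_moment v.
Proof.
rewrite /second_moment /samples_mean mulrA divff ?mulf_neq0 // mul1r.
under eq_bigr do rewrite sqn_rows; rewrite exchange_big; apply: eq_bigr => j _.
by rewrite [RHS](reindex_perm (pi j)); apply: eq_bigr => l _; rewrite rowK.
Qed.

(** The centred partial sum of the gradients consumed before step [k], whence the strict [l < k]. It
    vanishes at [k = m], where every sample has been seen. *)
Definition frozen_noise (v : 'rV[R]_p) (k : nat) : 'rV[R]_p :=
  \sum_(l < m | (l < k)%N) (agent_mean (frozen_gradients v l) - gradient (objective f) v).

Let U := \sum_(l < m) sqn (frozen_noise xbar l).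

Lemma sampled_frozen_drift_le k :
  sqn (\sum_(l < m | (l < k)%N) agent_mean (sampled_gradients l - frozen_gradients xbar l))
  <= m%:R * (L ^+ 2 * S).
Proof.
apply: le_trans (sqn_sum_le _ _) _; rewrite card_ord ler_pM2l // /S mulr_sumr.
rewrite big_mkcond /=; apply: ler_sum => l _; case: ifP => _.
  exact: sampled_frozen_mean_le.
by rewrite mulr_ge0 ?sqr_ge0 // deviation_ge0.
Qed.

Lemma epoch_descent : alpha * L * m%:R <= 1 ->
  objective f (agent_mean (inner_iterate m)) <=
  objective f xbar - alpha * m%:R / 2 * sqn grad + alpha * L ^+ 2 / 2 * S.
Proof.
move=> small; rewrite mean_inner_iterate //.
set D := \sum_(l < m | _) _; rewrite -scaleNr.
apply: le_trans (objective_upper_bound n0 m0 fs _ _) _; rewrite -/grad dotrZr sqnZ.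
have : sqn (D - m%:R *: grad) <= m%:R * (L ^+ 2 * S).
  apply: le_trans (sampled_frozen_drift_le m); rewrite -frozen_gradients_sum /D.
  have e (F : 'I_m -> 'rV[R]_p) : \sum_(l < m | (l < m)%N) F l = \sum_l F l.
    by apply: eq_bigl => l; rewrite ltn_ord.
  rewrite !e -sumrB le_eqVlt; apply/predU1P; left; congr sqn; apply: eq_bigr => l _.
  by rewrite agent_meanD -[in RHS]scaleN1r agent_meanZ scaleN1r.
rewrite sqnB dotrZr sqnZ dotrC => h.
set a := sqn D; set b := dotr grad D; set c := sqn grad.
(* With this factor the cross term of the expanded square is exactly the first-order term
   [alpha * dotr grad D]; its square term absorbs the quadratic one because [alpha * L * m <= 1]. *)
pose q := alpha / (2 * m%:R).
have q0 : 0 <= q by rewrite divr_ge0 ?mulr_ge0 // ltW.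
have := ler_wpM2r (mulr_ge0 q0 (sqn_ge0 D)) small; rewrite -/a mul1r.
have -> : alpha * L * m%:R * (q * a) = L / 2 * (alpha ^+ 2 * a) by rewrite /q; field.
have := ler_wpM2l q0 h; rewrite -/a -/b -/c.
have -> : q * (a - 2 * (m%:R * b) + m%:R ^+ 2 * c) =
  q * a - alpha * b + alpha * m%:R / 2 * c by rewrite /q; field.
have -> : q * (m%:R * (L ^+ 2 * S)) = alpha * L ^+ 2 / 2 * S by rewrite /q; field.
by rewrite sqrrN; lra.
Qed.

Let C l := n%:R^-1 * sqn (consensus_error (inner_iterate l)).

(** Sum the one-step contraction over the epoch and telescope; [(1 - r) / 2] is what the factor
    [(1 + r) / 2] leaves. Splitting sampled gradients into frozen ones plus an error doubles the
    constant 2 to 4. *)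
Lemma epoch_consensus :
  (1 - r) / 2 * \sum_(l < m) C l <= C 0%N - C m +
    4 * alpha ^+ 2 / (1 - r) * (L ^+ 2 * S + m%:R * second_moment xbar).
Proof.
have /andP[_ r1] := mixing_rate_sqr_ge0_lt1 aW; rewrite -/r in r1.
have ninv : 0 < n%:R^-1 :> R by rewrite invr_gt0.
have step (l : 'I_m) : (1 - r) / 2 * C l <= - (C l.+1 - C l) +
    4 * alpha ^+ 2 / (1 - r) * (L ^+ 2 * dev l + n%:R^-1 * sqn (frozen_gradients xbar l)).
  have := consensus_error_step n0 aW alpha (inner_iterate l) (sampled_gradients l).
  rewrite -inner_iterateS -/r => /(ler_wpM2l (ltW ninv)).
  have := sqnD_le (sampled_gradients l - frozen_gradients xbar l) (frozen_gradients xbar l).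
  rewrite subrK => /(ler_wpM2l (ltW ninv)).
  have := sampled_frozen_le l; rewrite /C.
  set d := sampled_gradients l - _; set z := frozen_gradients _ _.
  set a := sqn (consensus_error _); set b := sqn (consensus_error _).
  set g := sqn (sampled_gradients l) => dle gle.
  have coef0 : 0 <= 2 / (1 - r) * alpha ^+ 2.
    by rewrite mulr_ge0 ?sqr_ge0 // divr_ge0 // subr_ge0 ltW.
  have gz : n%:R^-1 * g <= 2 * (L ^+ 2 * dev l + n%:R^-1 * sqn z) by lra.
  have := ler_wpM2l coef0 gz.
  have -> : 4 * alpha ^+ 2 / (1 - r) = 2 * (2 / (1 - r) * alpha ^+ 2) by field; lra.
  by lra.
rewrite mulr_sumr; apply: le_trans (ler_sum _ (fun l _ => step l)) _.
rewrite big_split /= sumrN -mulr_sumr.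
have -> : \sum_(l < m) (C l.+1 - C l) = C m - C 0%N.
  by rewrite -(big_mkord xpredT (fun l => C l.+1 - C l)) telescope_sumr.
have -> : \sum_(l < m) (L ^+ 2 * dev l + n%:R^-1 * sqn (frozen_gradients xbar l)) =
    L ^+ 2 * S + m%:R * second_moment xbar.
  rewrite big_split /= /S mulr_sumr -[X in _ + X = _]mulr_sumr.
  by rewrite frozen_gradients_sqn; congr (_ + _); field.
by rewrite opprB.
Qed.

Lemma epoch_drift : \sum_(l < m) sqn (agent_mean (inner_iterate l) - xbar) <=
  alpha ^+ 2 * (2 * m%:R ^+ 2 * L ^+ 2 * S + 4 * U + 4 * m%:R ^+ 3 * sqn grad).
Proof.
have step (l : 'I_m) : sqn (agent_mean (inner_iterate l) - xbar) <=
    alpha ^+ 2 * (2 * (m%:R * (L ^+ 2 * S)) + 4 * sqn (frozen_noise xbar l)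
                  + 4 * (m%:R ^+ 2 * sqn grad)).
  rewrite mean_inner_iterate ?(ltnW (ltn_ord l)) // addrAC subrr add0r sqnN sqnZ.
  rewrite ler_pM2l ?exprn_gt0 //.
  have -> : \sum_(k < m | (k < l)%N) agent_mean (sampled_gradients k) =
     \sum_(k < m | (k < l)%N) agent_mean (sampled_gradients k - frozen_gradients xbar k)
     + (frozen_noise xbar l + l%:R *: grad).
    have -> : l%:R *: grad = \sum_(k < m | (k < l)%N) grad.
      rewrite -(big_ord_widen m (fun=> grad)) ?(ltnW (ltn_ord l)) //.
      by rewrite sumr_const card_ord scaler_nat.
    rewrite /frozen_noise -!big_split /=; apply: eq_bigr => k _.
    by rewrite subrK agent_meanD -scaleN1r agent_meanZ scaleN1r subrK.
  apply: le_trans (sqnD_le _ _) _; rewrite -addrA lerD //.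
    by rewrite ler_pM2l // sampled_frozen_drift_le.
  have : sqn (l%:R *: grad) <= m%:R ^+ 2 * sqn grad.
    rewrite sqnZ ler_wpM2r ?sqn_ge0 // ler_pXn2r ?nnegrE ?ler0n //.
    by rewrite ler_nat ltnW.
  by have := sqnD_le (frozen_noise xbar l) (l%:R *: grad); lra.
apply: le_trans (ler_sum _ (fun l _ => step l)) _.
have cst (c : R) : \sum_(l < m) c = m%:R * c by rewrite sumr_const card_ord mulr_natl.
rewrite -mulr_sumr !big_split /= !cst -mulr_sumr -/U.
by rewrite le_eqVlt; apply/predU1P; left; ring.
Qed.

Lemma deviation_split : S =
  \sum_(l < m) sqn (agent_mean (inner_iterate l) - xbar) + \sum_(l < m) C l.
Proof. by rewrite -big_split; apply: eq_bigr => l _; exact: deviationE. Qed.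

(** Consensus error and drift are each bounded by a small multiple of [S], which is their sum;
    solving for [S] and inserting it in the descent inequality gives the claim. *)
Lemma epoch_potential : 224 * (alpha * L * m%:R) ^+ 2 <= (1 - r) ^+ 2 ->
  objective f (agent_mean (inner_iterate m)) + 2 * alpha * L ^+ 2 / (1 - r) * C m <=
  objective f xbar + 2 * alpha * L ^+ 2 / (1 - r) * C 0%N - alpha * m%:R / 4 * sqn grad
  + 8 * alpha ^+ 3 * L ^+ 2 * m%:R / (1 - r) ^+ 2 * second_moment xbar
  + 4 * alpha ^+ 3 * L ^+ 2 * U.
Proof.
have /andP[r0 r1] := mixing_rate_sqr_ge0_lt1 aW; rewrite -/r in r0 r1.
set e := 1 - r => small.
have e0 : 0 < e by rewrite subr_gt0.
have e1 : e <= 1 by rewrite /e; lra.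
have b0 : 0 <= alpha * L * m%:R by rewrite !mulr_ge0 // ltW.
have esq1 : e ^+ 2 <= 1 by rewrite expr_le1 // ltW.
have small1 : alpha * L * m%:R <= 1.
  rewrite -(@ler_pXn2r _ 2) ?nnegrE // expr1n.
  by move: small esq1 (sqr_ge0 (alpha * L * m%:R)); lra.
have S0 : 0 <= S by apply: sumr_ge0 => l _; exact: deviation_ge0.
have := epoch_descent small1; have := epoch_consensus; have := epoch_drift.
have := deviation_split; rewrite -/e.
set D := \sum_(l < m) _; set Cs := \sum_(l < m) C l.
set F1 := objective f _; set F0 := objective f xbar; set G := sqn grad.
set M := second_moment xbar => SE drift cons descent.
have G0 : 0 <= G by exact: sqn_ge0.
have m1' : 1 <= m%:R :> R by rewrite ler1n.
(* Divide the stepsize condition by [e ^+ 2] and drop [m ^+ 2 >= 1]. *)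
have aL : 224 * (alpha ^+ 2 / e ^+ 2 * L ^+ 2) <= 1.
  have -> : 224 * (alpha ^+ 2 / e ^+ 2 * L ^+ 2) = (224 * (alpha * L) ^+ 2) / e ^+ 2.
    by field; rewrite gt_eqF.
  rewrite ler_pdivrMr ?exprn_gt0 // mul1r; apply: le_trans small.
  have aL0 : 0 <= alpha * L by rewrite mulr_ge0 // ltW.
  by rewrite ler_pM2l // ler_pXn2r ?nnegrE // ler_peMr.
have consS : Cs <= 2 / e * (C 0%N - C m) + 8 / 224 * S + 8 * (alpha ^+ 2 / e ^+ 2) * m%:R * M.
  have := ler_wpM2l (_ : 0 <= 2 / e) cons; rewrite divr_ge0 ?(ltW e0) // => /(_ isT).
  have -> : 2 / e * (e / 2 * Cs) = Cs by field; rewrite gt_eqF.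
  have -> : 2 / e * (C 0 - C m + 4 * alpha ^+ 2 / e * (L ^+ 2 * S + m%:R * M)) =
    2 / e * (C 0 - C m) + 8 * (alpha ^+ 2 / e ^+ 2 * L ^+ 2) * S
    + 8 * (alpha ^+ 2 / e ^+ 2) * m%:R * M.
    by field; rewrite gt_eqF.
  by have := ler_wpM2r S0 aL; lra.
have driftS : D <= 2 / 224 * S + 4 * alpha ^+ 2 * U + 4 * alpha ^+ 2 * m%:R ^+ 3 * G.
  apply: le_trans drift _.
  have := ler_wpM2r S0 (le_trans small esq1); lra.
(* The multiples of [S] on the right total [10 / 224], less than one half. *)
have half : 1 / 2 * S <= 2 / e * (C 0%N - C m) + 8 * (alpha ^+ 2 / e ^+ 2) * m%:R * M
    + 4 * alpha ^+ 2 * U + 4 * alpha ^+ 2 * m%:R ^+ 3 * G.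
  by move: SE; rewrite -/S -/D -/Cs; lra.
have aG0 : 0 <= alpha * m%:R * G by rewrite mulr_ge0 // mulr_ge0 // ltW.
(* The drift's gradient term thus costs at most [4 / 224] of [alpha * m * G], and the descent
   coefficient [1 / 2] can be lowered to [1 / 4]. *)
have aG : 224 * (alpha * L ^+ 2 * (alpha ^+ 2 * m%:R ^+ 3 * G)) <= alpha * m%:R * G.
  by have := ler_wpM2r aG0 (le_trans small esq1); lra.
(* This factor turns [S / 2] into the descent error, and the consensus difference into that of the
   potential, which explains the weight [2 * alpha * L ^+ 2 / (1 - r)]. *)
have := ler_wpM2l (_ : 0 <= alpha * L ^+ 2) half.
rewrite mulr_ge0 ?sqr_ge0 ?(ltW alpha0) // => /(_ isT).
have -> : alpha * L ^+ 2 * (2 / e * (C 0 - C m) + 8 * (alpha ^+ 2 / e ^+ 2) * m%:R * M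
    + 4 * alpha ^+ 2 * U + 4 * alpha ^+ 2 * m%:R ^+ 3 * G) =
  2 * alpha * L ^+ 2 / e * C 0%N - 2 * alpha * L ^+ 2 / e * C m
  + 8 * alpha ^+ 3 * L ^+ 2 * m%:R / e ^+ 2 * M + 4 * alpha ^+ 3 * L ^+ 2 * U
  + 4 * (alpha * L ^+ 2 * (alpha ^+ 2 * m%:R ^+ 3 * G)) by field; rewrite gt_eqF.
set t0 := _ * C 0%N; set tm := _ * C m; set tM := _ * M; set tU := _ * U.
by lra.
Qed.

End Epoch.

(** * Averages over uniform permutations *)

Section Reshuffling.
Variables (R : realType) (p : nat).

(* Distinct draws without replacement from a centred family are negatively
   correlated: all off-diagonal correlations are equal, and together with a
   diagonal one they sum to zero. *)
Lemma perm_correlation_le0 (m : nat) (u : 'I_m -> 'rV[R]_p) (k k' : 'I_m) :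
  \sum_l u l = 0 -> k != k' ->
  \sum_(s : 'S_m) dotr (u (s k)) (u (s k')) <= 0.
Proof.
move=> u0 kk'; pose T l := \sum_(s : 'S_m) dotr (u (s k)) (u (s l)).
have Tcst l : l != k -> T l = T k'.
  move=> lk; rewrite /T (reindex_inj (mulgI (tperm l k'))) /=.
  by apply: eq_bigr => s _; rewrite !permM tpermL tpermD // eq_sym.
have : \sum_l T l = 0.
  rewrite exchange_big /= big1 // => s _.
  have us0 : \sum_l u (s l) = 0 by rewrite -[RHS]u0 [RHS](reindex_perm s); apply: eq_bigr.
  by rewrite -dotr_sumr us0 dotrC dotr0l.
rewrite (bigD1 k) //= (eq_bigr (fun=> T k')) //.
rewrite sumr_const -mulr_natr; set c := #|_|%:R => e.
have Tk : 0 <= T k by apply: sumr_ge0 => s _; rewrite dotrr sqn_ge0.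
have c0 : 0 < c by rewrite ltr0n; apply/card_gt0P; exists k'; rewrite unfold_in eq_sym.
by rewrite -[X in X <= 0]/(T k') -(pmulr_lle0 _ c0); lra.
Qed.

(** Expand the square: the off-diagonal terms have nonpositive total, and the diagonal ones extend
    from [A] to all indices. *)
Lemma perm_partial_sum_le (m : nat) (u : 'I_m -> 'rV[R]_p) (A : pred 'I_m) :
  \sum_l u l = 0 ->
  \sum_(s : 'S_m) sqn (\sum_(k | A k) u (s k)) <= #|'S_m|%:R * \sum_l sqn (u l).
Proof.
move=> u0.
have e (s : 'S_m) : sqn (\sum_(k | A k) u (s k)) =
    \sum_(k | A k) sqn (u (s k))
    + \sum_(k | A k) \sum_(k' | A k' && (k' != k)) dotr (u (s k)) (u (s k')).
  rewrite -dotrr dotr_suml -big_split /=; apply: eq_bigr => k Ak.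
  by rewrite dotr_sumr (bigD1 k) //= dotrr.
under eq_bigr do rewrite e; rewrite big_split /= -[leRHS]addr0 lerD //; last first.
  rewrite exchange_big /= sumr_le0 // => k _.
  rewrite exchange_big /= sumr_le0 // => k' /andP[_ k'k].
  by apply: perm_correlation_le0 => //; rewrite eq_sym.
rewrite mulr_natl -sumr_const; apply: ler_sum => s _.
rewrite [leRHS](reindex_perm s) /= [leRHS](bigID A) /= lerDl.
by apply: sumr_ge0 => l _; exact: sqn_ge0.
Qed.

(** Each coordinate of a uniform tuple is uniform, stated without division. Left translation by [s]
    permutes the tuples, while [s * b j] runs through the whole group as [s] varies. *)
Lemma sum_ffun_coordinate (n m : nat) (phi : 'S_m -> R) (j : 'I_n) :
  #|'S_m|%:R * \sum_(b : {ffun 'I_n -> 'S_m}) phi (b j) =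
  #|{ffun 'I_n -> 'S_m}|%:R * \sum_s phi s.
Proof.
pose left_mul (s : 'S_m) (b : {ffun 'I_n -> 'S_m}) := [ffun i => (s * b i)%g].
have inj s : injective (left_mul s).
  by move=> b b' /ffunP e; apply/ffunP => i; move: (e i); rewrite !ffunE => /mulgI.
rewrite !mulr_natl -!sumr_const.
rewrite (eq_bigr (fun s => \sum_b phi (left_mul s b j))); last first.
  by move=> s _; rewrite (reindex_inj (inj s)).
rewrite exchange_big; apply: eq_bigr => b _.
rewrite [RHS](reindex_inj (mulIg (b j))).
by apply: eq_bigr => s _; rewrite ffunE.
Qed.

Variables (n m : nat) (f : 'I_n -> 'I_m -> 'rV[R]_p -> R).
Hypotheses (n0 : (0 < n)%N) (m0 : (0 < m)%N).
Variable L : R.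
Hypothesis fs : forall i l, smooth L (f i l).

Let n1 : n%:R != 0 :> R. Proof. by rewrite pnatr_eq0 -lt0n. Qed.
Let m1 : m%:R != 0 :> R. Proof. by rewrite pnatr_eq0 -lt0n. Qed.
Let npos : 0 < n%:R :> R. Proof. by rewrite ltr0n. Qed.
Let mpos : 0 < m%:R :> R. Proof. by rewrite ltr0n. Qed.

Let centred (v : 'rV[R]_p) j l :=
  gradient (f j l) v - m%:R^-1 *: \sum_l gradient (f j l) v.

Lemma centred_sum0 v j : \sum_l centred v j l = 0.
Proof.
rewrite sumrB sumr_const card_ord -scaler_nat scalerA divff // scale1r.
by rewrite subrr.
Qed.

(** A variance is at most the second moment. *)
Lemma centred_sqn_le v j :
  \sum_l sqn (centred v j l) <= \sum_l sqn (gradient (f j l) v).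
Proof.
under eq_bigr do rewrite sqnB.
rewrite !big_split /= sumrN sumr_const card_ord -mulr_sumr -dotr_suml.
set g := \sum_l gradient (f j l) v; rewrite dotrZr dotrr sqnZ.
rewrite -addrA gerDl -(mulr_natl (_ * sqn g)).
have -> : - (2 * (m%:R^-1 * sqn g)) + m%:R * (m%:R^-1 ^+ 2 * sqn g) = - (m%:R^-1 * sqn g).
  by field.
by rewrite oppr_le0 mulr_ge0 ?sqn_ge0 // invr_ge0 ltW.
Qed.

Lemma frozen_noiseE (b : 'I_n -> 'S_m) v k : frozen_noise f b v k =
  n%:R^-1 *: \sum_j \sum_(l < m | (l < k)%N) centred v j (b j l).
Proof.
rewrite /frozen_noise exchange_big /= scaler_sumr; apply: eq_bigr => l _.
rewrite sumrB scalerBr (objective_gradient fs); congr (_ *: _ - _).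
by apply: eq_bigr => j _; rewrite rowK.
Qed.

(** Convexity reduces the noise to partial sums of single agents, handled by the without-replacement
    bound. One factor [m] counts the steps [l], the other turns a sum over samples into a mean. *)
Lemma frozen_noise_average v :
  \sum_(b : {ffun 'I_n -> 'S_m}) \sum_(l < m) sqn (frozen_noise f b v l) <=
  #|{ffun 'I_n -> 'S_m}|%:R * (m%:R ^+ 2 * second_moment f v).
Proof.
have Spos : 0 < #|'S_m|%:R :> R by rewrite ltr0n card_Sn fact_gt0.
have noise (l : 'I_m) (b : {ffun 'I_n -> 'S_m}) : sqn (frozen_noise f b v l) <=
    n%:R^-1 * \sum_j sqn (\sum_(k < m | (k < l)%N) centred v j (b j k)).
  rewrite frozen_noiseE sqnZ expr2 -mulrA ler_pM2l ?invr_gt0 // ler_pdivrMl //.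
  by apply: le_trans (sqn_sum_le _ _) _; rewrite card_ord.
have agent (l : 'I_m) (j : 'I_n) :
    \sum_(b : {ffun 'I_n -> 'S_m}) sqn (\sum_(k < m | (k < l)%N) centred v j (b j k))
    <= #|{ffun 'I_n -> 'S_m}|%:R * \sum_k sqn (gradient (f j k) v).
  rewrite -(ler_pM2l Spos).
  rewrite (sum_ffun_coordinate (fun s : 'S_m => sqn (\sum_(k < m | (k < l)%N) centred v j (s k)))).
  rewrite mulrCA ler_wpM2l //.
  apply: le_trans (perm_partial_sum_le _ (centred_sum0 v j)) _.
  by rewrite ler_pM2l // centred_sqn_le.
rewrite exchange_big /=.
have -> : #|{ffun 'I_n -> 'S_m}|%:R * (m%:R ^+ 2 * second_moment f v) =
  \sum_(l < m) n%:R^-1 * \sum_j #|{ffun 'I_n -> 'S_m}|%:R * \sum_k sqn (gradient (f j k) v).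
  rewrite sumr_const card_ord -mulr_natl -mulr_sumr /second_moment /samples_mean.
  by field; rewrite n1 m1.
apply: ler_sum => l _; apply: le_trans (ler_sum _ (fun b _ => noise l b)) _.
rewrite -[leLHS]mulr_sumr ler_pM2l ?invr_gt0 // exchange_big /=.
by apply: ler_sum => j _; exact: agent.
Qed.

End Reshuffling.

(** * Telescoping with a small growth rate *)

(** The accumulated growth [(1 + c) ^+ T] stays below 2 since [c * T <= 1 / 2], so the recursion
    telescopes at the price of a factor 2. *)
Lemma descent_recursion (R : realFieldType) (q g : nat -> R) (b c s G : R) (T : nat) :
  0 <= b -> 0 <= c -> 0 <= s -> 0 <= G -> c * T%:R <= 1 / 2 ->
  0 <= q 0%N -> 0 <= q T ->
  (forall t, (t < T)%N -> q t.+1 <= (1 + c) * q t - b * g t + c * s) ->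
  (forall t, (t < T)%N -> G <= g t) ->
  b * T%:R * G <= 2 * (q 0%N + c * T%:R * s).
Proof.
move=> b0 c0 s0 G0 cT q0 qT step gG.
have p1 k : 1 <= (1 + c) ^+ k by rewrite exprn_ege1 // lerDl.
have grow k : (k <= T)%N -> q k + b * k%:R * G <= (1 + c) ^+ k * (q 0%N + c * k%:R * s).
  elim: k => [_|k IH kT]; first by rewrite !mulr0 !mul0r expr0 !addr0 mul1r.
  have := IH (ltnW kT); rewrite -(ler_pM2l (_ : 0 < 1 + c)) ?ltr_pwDl // mulrA -exprS.
  have := step _ kT; have := ler_wpM2l b0 (gG _ kT).
  have : 0 <= c * (b * k%:R * G) by rewrite !mulr_ge0.
  have : c * s <= (1 + c) ^+ k.+1 * (c * s) by rewrite ler_peMl ?mulr_ge0.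
  rewrite -[k.+1%:R]natr1.
  by set P := (1 + c) ^+ k.+1; lra.
(* A division-free form of [(1 + c) ^+ k <= 1 / (1 - c * k)], in place of an exponential
   estimate. *)
have bound k : (1 + c) ^+ k * (1 - c * k%:R) <= 1.
  elim: k => [|k IH]; first by rewrite mulr0 subr0 mulr1.
  apply: le_trans IH; rewrite exprSr -mulrA ler_wpM2l ?exprn_ge0 ?addr_ge0 //.
  rewrite -[k.+1%:R]natr1 -subr_ge0.
  have -> : 1 - c * k%:R - (1 + c) * (1 - c * (k%:R + 1)) = c ^+ 2 * (k%:R + 1) by ring.
  by rewrite mulr_ge0 ?sqr_ge0 // addr_ge0.
have P2 : (1 + c) ^+ T <= 2.
  have := bound T; have : (1 + c) ^+ T * (1 / 2) <= (1 + c) ^+ T * (1 - c * T%:R).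
    by rewrite ler_wpM2l ?exprn_ge0 ?addr_ge0 //; lra.
  by lra.
have := grow T (leqnn T); have : 0 <= q 0%N + c * T%:R * s by rewrite addr_ge0 // !mulr_ge0.
by move=> Q0; have := ler_wpM2r Q0 P2; lra.
Qed.

(** * The potential averaged over one epoch *)

Section Potential.
Variables (R : realType) (n m p : nat) (f : 'I_n -> 'I_m -> 'rV[R]_p -> R).
Hypotheses (n0 : (0 < n)%N) (m0 : (0 < m)%N).
Variable L : R.
Hypotheses (L0 : 0 < L) (fs : forall i l, smooth L (f i l)).
Hypothesis fb : forall i l, has_lbound (range (f i l)).
Variables (W : 'M[R]_n) (alpha : R).
Hypotheses (aW : admissible_mixing W) (alpha0 : 0 < alpha).

Let r := mixing_rate W ^+ 2.

Definition potential (x : 'M[R]_(n, p)) : R :=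
  objective f (agent_mean x) - inf_value (objective f)
  + 2 * alpha * L ^+ 2 / (1 - r) * (n%:R^-1 * sqn (consensus_error x)).

(** The constant 24 is 12, from the collected second-moment coefficients, times 2 from the factor
    [2 * L] in the gradient bound. *)
Definition growth_rate : R := 24 * alpha ^+ 3 * L ^+ 3 * m%:R ^+ 2 / (1 - r) ^+ 2.

Let e0 : 0 < 1 - r.
Proof. by have /andP[_] := mixing_rate_sqr_ge0_lt1 aW; rewrite subr_gt0. Qed.

Lemma potential_ge x : objective f (agent_mean x) - inf_value (objective f) <= potential x.
Proof.
by rewrite lerDl !mulr_ge0 ?sqn_ge0 ?sqr_ge0 ?invr_ge0 ?ler0n // ltW.
Qed.

Lemma potential_ge0 x : 0 <= potential x.
Proof. by apply: le_trans (potential_ge x); rewrite subr_ge0 inf_objective_le. Qed.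

Lemma growth_rate_ge0 : 0 <= growth_rate.
Proof. by rewrite divr_ge0 ?sqr_ge0 // !mulr_ge0 ?sqr_ge0 ?exprn_ge0 // ltW. Qed.

(** Averaging replaces the noise by the second moment; bounding the latter through function values
    yields the growth of the potential and the [sigma_star] term. *)
Lemma potential_average x : 224 * (alpha * L * m%:R) ^+ 2 <= (1 - r) ^+ 2 ->
  \sum_(b : {ffun 'I_n -> 'S_m}) potential (drr_epoch f W alpha b x) <=
  #|{ffun 'I_n -> 'S_m}|%:R * ((1 + growth_rate) * potential x
    - alpha * m%:R / 4 * sqn (gradient (objective f) (agent_mean x))
    + growth_rate * sigma_star f).
Proof.
move=> small.
set M := second_moment f (agent_mean x); set g := sqn (gradient _ _).
pose A := potential x - alpha * m%:R / 4 * g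
  + 8 * alpha ^+ 3 * L ^+ 2 * m%:R / (1 - r) ^+ 2 * M.
pose k := 4 * alpha ^+ 3 * L ^+ 2.
have k0 : 0 <= k by rewrite !mulr_ge0 ?exprn_ge0 // ltW.
have one (b : {ffun 'I_n -> 'S_m}) : potential (drr_epoch f W alpha b x) <=
    A + k * \sum_(l < m) sqn (frozen_noise f b (agent_mean x) l).
  have := epoch_potential n0 m0 L0 fs aW alpha0 x b small.
  rewrite inner_iterate_epoch inner_iterate0 -/r -/g -/M /A /potential -/k.
  by lra.
apply: le_trans (ler_sum _ (fun b _ => one b)) _.
have := ler_wpM2l k0 (frozen_noise_average n0 m0 fs (agent_mean x)).
have cst : \sum_(b : {ffun 'I_n -> 'S_m}) A = #|{ffun 'I_n -> 'S_m}|%:R * A.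
  by rewrite sumr_const mulr_natl.
rewrite big_split /= -mulr_sumr cst -/M; set B := #|_|%:R => noise.
have B0 : 0 <= B by [].
apply: (@le_trans _ _ (B * (A + k * (m%:R ^+ 2 * M)))); first by lra.
rewrite ler_wpM2l // /A.
have M0 : 0 <= M.
  rewrite mulr_ge0 ?invr_ge0 ?mulr_ge0 ?ler0n // sumr_ge0 // => i _.
  by rewrite sumr_ge0 // => l _; exact: sqn_ge0.
have Mle := gradient_second_moment L0 fs fb (agent_mean x).
rewrite -/(second_moment f (agent_mean x)) -/M in Mle.
(* Here 12 is 8 + 4, the two terms being made alike by [m <= m ^+ 2] and [(1 - r) ^+ 2 <= 1]. *)
have coef : 8 * alpha ^+ 3 * L ^+ 2 * m%:R / (1 - r) ^+ 2 + k * m%:R ^+ 2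
    <= 12 * (alpha ^+ 3 * L ^+ 2 * m%:R ^+ 2 / (1 - r) ^+ 2).
  have a0 : 0 <= alpha ^+ 3 * L ^+ 2 by rewrite mulr_ge0 ?exprn_ge0 // ltW.
  have mm : m%:R <= m%:R ^+ 2 :> R by rewrite -natrX ler_nat leq_pmull.
  have i1 : 1 <= ((1 - r) ^+ 2)^-1.
    rewrite invf_ge1 ?exprn_gt0 // expr_le1 ?(ltW e0) //.
    by have /andP[] := mixing_rate_sqr_ge0_lt1 aW; rewrite -/r; lra.
  have i0 : 0 <= ((1 - r) ^+ 2)^-1 by rewrite invr_ge0 sqr_ge0.
  have t1 := ler_wpM2l (mulr_ge0 a0 i0) mm.
  have t2 := ler_wpM2l (mulr_ge0 a0 (sqr_ge0 m%:R)) i1.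
  by rewrite /k; lra.
have := ler_wpM2r M0 coef.
have c0 : 0 <= 12 * (alpha ^+ 3 * L ^+ 2 * m%:R ^+ 2 / (1 - r) ^+ 2).
  by rewrite mulr_ge0 // divr_ge0 ?sqr_ge0 // !mulr_ge0 ?exprn_ge0 // ltW.
have := ler_wpM2l c0 Mle.
have -> : 12 * (alpha ^+ 3 * L ^+ 2 * m%:R ^+ 2 / (1 - r) ^+ 2) *
   (2 * L * (objective f (agent_mean x) - inf_value (objective f) + sigma_star f)) =
   growth_rate * (objective f (agent_mean x) - inf_value (objective f))
   + growth_rate * sigma_star f.
  by rewrite /growth_rate; field; rewrite gt_eqF.
have := ler_wpM2l growth_rate_ge0 (potential_ge x).
by lra.
Qed.

End Potential.

(** * From expectations to finite averages *)

(** [phi \o Z] is a finite combination of indicators of the level sets of [Z]. *)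
Lemma expectation_finite (d : measure_display) (Omega : measurableType d) (R : realType)
    (P : probability Omega R) (S : finType) (Z : Omega -> S) (phi : S -> R) :
  finite_random_variable Z ->
  ('E_P[phi \o Z] = \sum_s (phi s)%:E * P (Z @^-1` [set s]))%E.
Proof.
move=> mZ; rewrite unlock.
pose g s w := ((phi s)%:E * (\1_(Z @^-1` [set s]) w)%:E)%E : \bar R.
have gi s : P.-integrable setT (fun w => (\1_(Z @^-1` [set s]) w)%:E : \bar R).
  exact: integrable_indic.
rewrite (eq_integral (fun w => \sum_s g s w)%E); last first.
  move=> w _; rewrite (bigD1 (Z w)) //= big1 => [|s sZ].
    by rewrite adde0 /g indicE mem_set // mule1.
  rewrite /g indicE memNset ?mule0 //= => Zs.
  by move: sZ; rewrite Zs eqxx.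
rewrite integral_sum //; last by move=> s; exact: integrableZl.
apply: eq_bigr => s _; rewrite integralZl // integral_indic //.
by rewrite setIT.
Qed.

Lemma drr_eq (R : realType) (n m p : nat) (f : 'I_n -> 'I_m -> 'rV[R]_p -> R)
    (W : 'M[R]_n) (alpha : R) x0 (pi pi' : nat -> 'I_n -> 'S_m) (t : nat) :
  (forall s, (s < t)%N -> pi s = pi' s) ->
  drr f W alpha x0 pi t = drr f W alpha x0 pi' t.
Proof.
elim: t => [//|t IH] e /=; rewrite e // IH // => s st; apply: e.
exact: leq_trans st _.
Qed.

Section EpochExpectation.
Variables (d : measure_display) (Omega : measurableType d) (R : realType).
Variables (P : probability Omega R) (n m p : nat).
Variable pi : nat -> 'I_n -> Omega -> 'S_m.
Hypothesis hpi : random_reshuffling P pi.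
Variables (f : 'I_n -> 'I_m -> 'rV[R]_p -> R) (W : 'M[R]_n) (alpha : R).
Variable x0 : 'M[R]_(n, p).

Let state t w := drr f W alpha x0 (fun s i => pi s i w) t.

Let past t := {ffun 'I_t * 'I_n -> 'S_m}.
Let draw := {ffun 'I_n -> 'S_m}.

(** All draws up to and including epoch [t] as one finite-valued variable, with the current draw
    kept apart from the past so that it can be averaged first. *)
Let outcome t (w : Omega) : past t * draw :=
  ([ffun si : 'I_t * 'I_n => pi si.1 si.2 w], [ffun i => pi t i w]).

(* Beyond epoch t the history is irrelevant and keeps repeating the last draw. *)
Let history t (z : past t * draw) (s : nat) (i : 'I_n) : 'S_m :=
  if insub s is Some s' then z.1 (s', i) else z.2 i.

Let indices t : seq (nat * 'I_n) := [seq (s, i) | s <- iota 0 t.+1, i <- enum 'I_n].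

(** Puts the event in the form of an intersection over indices, to which [mutually_independent]
    applies. *)
Lemma preimage_outcome t z : outcome t @^-1` [set z] =
  \bigcap_(j in [set` indices t]) (fun w => pi j.1 j.2 w) @^-1` [set history z j.1 j.2].
Proof.
apply/seteqP; split=> [w <- [s i] /=|w H].
  move=> /allpairsP[[s' i'] /= [s't _ [-> ->]]].
  rewrite /history; case: insubP => [u _ us|] /=; first by rewrite ffunE us.
  rewrite -leqNgt ffunE => ts'.
  move: s't; rewrite -[_ :: _]/(iota 0 t.+1) mem_iota add0n ltnS /= => s't.
  by rewrite (@anti_leq s' t) // s't.
have {}H s i : (s <= t)%N -> pi s i w = history z s i.
  move=> st; apply: (H (s, i)); apply/allpairsP; exists (s, i).
  by rewrite mem_iota add0n ltnS st mem_enum.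
case: z H => a b H; rewrite /= /outcome; congr (_, _); apply/ffunP.
  by move=> [s i]; rewrite ffunE (H _ _ (ltnW (ltn_ord s))) /history valK.
by move=> i; rewrite ffunE (H _ _ (leqnn t)) /history insubF // ltnn.
Qed.

Lemma finite_random_variable_outcome t : finite_random_variable (outcome t).
Proof.
case: hpi => mpi _ _ z; rewrite preimage_outcome.
by apply: fin_bigcap_measurable => // -[s i] _; exact: mpi.
Qed.

Lemma outcome_uniform t z : P (outcome t @^-1` [set z]) =
  ((#|'S_m|%:R^-1) ^+ size (indices t))%:E.
Proof.
case: hpi => _ upi ipi.
rewrite preimage_outcome (ipi (indices t) (fun j => [set history z j.1 j.2])); last first.
  by rewrite allpairs_uniq ?iota_uniq ?enum_uniq // => -[? ?] [? ?].
elim: (indices t) => [|j J IH]; first by rewrite big_nil.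
by rewrite big_cons IH upi exprS EFinM.
Qed.

(* The law of the state after epoch t is obtained from the state before it by
   averaging over a uniform draw of all the permutations. *)
Lemma epoch_expectation (t : nat) : exists (A : finType) (X : A -> 'M[R]_(n, p)) (c : R),
  [/\ 0 <= c, c * #|A|%:R * #|draw|%:R = 1,
    forall h : 'M[R]_(n, p) -> R,
      'E_P[fun w => h (state t w)]%E = (c * \sum_a #|draw|%:R * h (X a))%:E &
    forall h : 'M[R]_(n, p) -> R,
      'E_P[fun w => h (state t.+1 w)]%E =
      (c * \sum_a \sum_(b : draw) h (drr_epoch f W alpha b (X a)))%:E].
Proof.
(* The identity permutations are a dummy current draw: the first [t] epochs never read it. *)
pose X (a : past t) := drr f W alpha x0 (history (a, [ffun=> 1%g])) t.
pose c : R := (#|'S_m|%:R^-1) ^+ size (indices t).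
have stateE w : state t w = X (outcome t w).1.
  apply: drr_eq => s st; apply/funext => i.
  by rewrite /history insubT /= ffunE.
have stateSE w : state t.+1 w = drr_epoch f W alpha (outcome t w).2 (X (outcome t w).1).
  rewrite -stateE -[LHS]/(drr_epoch f W alpha (fun i => pi t i w) (state t w)).
  have -> // : (fun i => pi t i w) = (outcome t w).2 by apply/funext => i; rewrite ffunE.
have E (phi : past t * draw -> R) :
    'E_P[fun w => phi (outcome t w)]%E = (c * \sum_a \sum_b phi (a, b))%:E.
  rewrite (expectation_finite P phi (@finite_random_variable_outcome t)).
  under eq_bigr do rewrite outcome_uniform -EFinM.
  rewrite sumEFin -mulr_suml mulrC pair_bigA; congr (_ * _)%:E.
  by apply: eq_bigr => -[].
exists (past t), X, c; split.
- by rewrite exprn_ge0 // invr_ge0.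
(* Normalization of the weights is the expectation of the constant 1. *)
- have := E (fun=> 1); rewrite expectation_cst => -[e].
  rewrite [RHS]e -mulrA; congr (_ * _).
  under eq_bigr do rewrite sumr_const.
  by rewrite sumr_const -mulrnA -natrM mulnC.
- move=> h; under eq_fun do rewrite stateE.
  rewrite (E (fun z => h (X z.1))); congr (_ * _)%:E; apply: eq_bigr => a _ /=.
  by rewrite sumr_const mulr_natl.
- move=> h; under eq_fun do rewrite stateSE.
  by rewrite (E (fun z => h (drr_epoch f W alpha z.2 (X z.1)))).
Qed.

End EpochExpectation.

(** * Stepsize conditions and the explicit stepsize *)

Lemma cube_root_powR (R : realType) (y : R) : 0 <= y -> (y `^ (1 / 3)) ^+ 3 = y.
Proof.
move=> y0; rewrite -powR_mulrn ?powR_ge0 // -powRrM.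
by rewrite div1r mulVf ?powRr1 // pnatr_eq0.
Qed.

Lemma cube_powR23 (R : realType) (y : R) : 0 <= y -> (y `^ (2 / 3)) ^+ 3 = y ^+ 2.
Proof.
move=> y0; rewrite -powR_mulrn ?powR_ge0 // -powRrM.
by rewrite divfK ?pnatr_eq0 // powR_mulrn.
Qed.

Lemma ler_cube (R : realType) (x y : R) : 0 <= x -> 0 <= y -> x ^+ 3 <= y ^+ 3 -> x <= y.
Proof. by move=> x0 y0; rewrite ler_pXn2r. Qed.

Section FinalBounds.
Variables (R : realType) (m T e L alpha : R).
Hypotheses (m0 : 0 < m) (T0 : 0 < T) (e0 : 0 < e) (L0 : 0 < L) (alpha0 : 0 < alpha).

Let denominator_gt0 : 0 < 384 * m ^+ 2 * L ^+ 3 * T.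
Proof.
apply: mulr_gt0 T0; apply: mulr_gt0 (exprn_gt0 3 L0).
by apply: mulr_gt0 (exprn_gt0 2 m0); rewrite ltr0n.
Qed.

(** The constant is [224 = 4 ^ 2 * 14]. *)
Lemma step_sqr_le : alpha <= e / (4 * m * L * Num.sqrt 14) ->
  224 * (alpha * L * m) ^+ 2 <= e ^+ 2.
Proof.
have s0 : 0 < Num.sqrt (14 : R) by rewrite sqrtr_gt0.
have s2 : Num.sqrt (14 : R) ^+ 2 = 14 by rewrite sqr_sqrtr.
rewrite ler_pdivlMr ?mulr_gt0 // => h.
have -> : 224 * (alpha * L * m) ^+ 2 = (alpha * (4 * m * L * Num.sqrt 14)) ^+ 2.
  by rewrite !exprMn s2; ring.
by rewrite ler_pXn2r ?nnegrE ?(ltW e0) // !mulr_ge0 // ltW.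
Qed.

Lemma step_cube_le : alpha <= (e ^+ 2 / (384 * m ^+ 2 * L ^+ 3 * T)) `^ (1 / 3) ->
  384 * (alpha ^+ 3 * L ^+ 3 * m ^+ 2 * T) <= e ^+ 2.
Proof.
move=> h.
have y0 := divr_ge0 (sqr_ge0 e) (ltW denominator_gt0).
have : alpha ^+ 3 <= e ^+ 2 / (384 * m ^+ 2 * L ^+ 3 * T).
  by rewrite -(cube_root_powR y0) ler_pXn2r ?nnegrE ?powR_ge0 // ltW.
by rewrite ler_pdivlMr //; lra.
Qed.

Let A := 4 * Num.sqrt 14 * m * L / e.
Let B := (384 * m ^+ 2 * L ^+ 3 * T / e ^+ 2) `^ (1 / 3).
Let D := e `^ (2 / 3) * m `^ (1 / 3) * T `^ (2 / 3).

(** As [1 / alpha = A + B], the first term splits into an [A] part, giving the rate [1 / T], and a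
    [B] part, while [alpha <= 1 / B] controls the [sigma_star] term. Fractional powers are compared
    after cubing. *)
Lemma explicit_step_le (gap c s : R) : 0 <= gap -> 0 <= s -> alpha = (A + B)^-1 ->
  12 * gap / (alpha * m * T) + c + 984 * alpha ^+ 2 * m * L ^+ 3 * s / e ^+ 2 <=
  (88 * L * gap + 20 * L * s) / D + c + 48 * Num.sqrt 14 * L * gap / (e * T).
Proof.
move=> gap0 s0 ->.
have y0 := divr_gt0 denominator_gt0 (exprn_gt0 2 e0).
have A0 : 0 < A by rewrite divr_gt0 // !mulr_gt0 // sqrtr_gt0.
have B0 : 0 < B by rewrite powR_gt0.
have D0 : 0 < D by rewrite !mulr_gt0 ?powR_gt0.
have B3 : B ^+ 3 = 384 * m ^+ 2 * L ^+ 3 * T / e ^+ 2 by exact: cube_root_powR (ltW y0).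
have D3 : D ^+ 3 = e ^+ 2 * m * T ^+ 2.
  by rewrite !exprMn !cube_powR23 ?cube_root_powR // ltW.
(* From here on [B] and [D] enter only through their positivity and their cubes. *)
clearbody B D.
(* After cubing, [22 ^ 3 - 27 * 384 = 280]; four times this inequality turns 12 into 88. *)
have BD : 3 * B * D <= 22 * L * m * T.
  apply: ler_cube; [by rewrite !mulr_ge0 // ltW | by rewrite !mulr_ge0 // ltW |].
  rewrite !exprMn B3 D3 -subr_ge0.
  have -> : 22 ^+ 3 * L ^+ 3 * m ^+ 3 * T ^+ 3
    - 3 ^+ 3 * (384 * m ^+ 2 * L ^+ 3 * T / e ^+ 2) * (e ^+ 2 * m * T ^+ 2) =
    280 * (L * m * T) ^+ 3 by field; rewrite gt_eqF.
  by apply: mulr_ge0; rewrite ?ler0n // exprn_ge0 // !mulr_ge0 // ltW.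
(* After cubing this is [50 ^ 3 <= 384 ^ 2]; then [984 / 50 <= 20] gives the constant 20. *)
have BBD : 50 * m * L ^+ 2 * D <= e ^+ 2 * B ^+ 2.
  apply: ler_cube; [by rewrite !mulr_ge0 ?sqr_ge0 // ltW | by rewrite mulr_ge0 ?sqr_ge0 |].
  have -> : (e ^+ 2 * B ^+ 2) ^+ 3 = e ^+ 6 * (B ^+ 3) ^+ 2 by ring.
  have -> : (50 * m * L ^+ 2 * D) ^+ 3 = 50 ^+ 3 * m ^+ 3 * (L ^+ 2) ^+ 3 * D ^+ 3 by ring.
  rewrite B3 D3 -subr_ge0.
  have -> : e ^+ 6 * (384 * m ^+ 2 * L ^+ 3 * T / e ^+ 2) ^+ 2
     - 50 ^+ 3 * m ^+ 3 * (L ^+ 2) ^+ 3 * (e ^+ 2 * m * T ^+ 2) =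
    (384 ^+ 2 - 50 ^+ 3) * (L ^+ 6 * m ^+ 4 * T ^+ 2 * e ^+ 2) by field; rewrite gt_eqF.
  have num : 0 <= 384 ^+ 2 - 50 ^+ 3 :> R by lra.
  by rewrite mulr_ge0 // !mulr_ge0 ?exprn_ge0 // ltW.
have t1 : 12 * gap / ((A + B)^-1 * m * T) <=
   88 * L * gap / D + 48 * Num.sqrt 14 * L * gap / (e * T).
  have -> : 12 * gap / ((A + B)^-1 * m * T) =
     4 * (3 * B * D * (gap / (m * T * D))) + 48 * Num.sqrt 14 * L * gap / (e * T).
    have -> : 48 * Num.sqrt 14 * L * gap / (e * T) = 12 * gap * A / (m * T).
      by rewrite /A; field; rewrite !gt_eqF.
    have AB0 : 0 < A + B by rewrite addr_gt0.
    by field; rewrite !gt_eqF.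
  rewrite lerD2r; have q0 : 0 <= gap / (m * T * D) by rewrite divr_ge0 // !mulr_ge0 // ltW.
  have -> : 88 * L * gap / D = 4 * (22 * L * m * T * (gap / (m * T * D))).
    by field; rewrite !gt_eqF.
  by rewrite ler_pM2l // ler_wpM2r.
have t2 : 984 * (A + B)^-1 ^+ 2 * m * L ^+ 3 * s / e ^+ 2 <= 20 * L * s / D.
  have q0 : 0 <= L * s / (e ^+ 2 * B ^+ 2 * D).
    by rewrite divr_ge0 // ?mulr_ge0 ?sqr_ge0 // ltW.
  have BBDs : 984 * m * L ^+ 2 * D <= 20 * (e ^+ 2 * B ^+ 2).
    have p0 : 0 <= m * L ^+ 2 * D by rewrite !mulr_ge0 ?sqr_ge0 // ltW.
    by lra.
  have := ler_wpM2r q0 BBDs.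
  have -> : 20 * (e ^+ 2 * B ^+ 2) * (L * s / (e ^+ 2 * B ^+ 2 * D)) = 20 * L * s / D.
    by field; rewrite !gt_eqF.
  have -> : 984 * m * L ^+ 2 * D * (L * s / (e ^+ 2 * B ^+ 2 * D)) =
     984 * m * L ^+ 3 * s / e ^+ 2 * B^-1 ^+ 2 by field; rewrite !gt_eqF.
  apply: le_trans.
  have -> : 984 * (A + B)^-1 ^+ 2 * m * L ^+ 3 * s / e ^+ 2 =
    984 * m * L ^+ 3 * s / e ^+ 2 * (A + B)^-1 ^+ 2 by ring.
  have L30 : 0 <= L ^+ 3 by rewrite exprn_ge0 // ltW.
  have c0 : 0 <= 984 :> R by rewrite ler0n.
  apply: ler_wpM2l.
    exact: divr_ge0 (mulr_ge0 (mulr_ge0 (mulr_ge0 c0 (ltW m0)) L30) s0) (sqr_ge0 e).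
  rewrite ler_pXn2r ?nnegrE ?invr_ge0 ?addr_ge0 ?(ltW A0) ?(ltW B0) //.
  by rewrite lef_pV2 ?posrE ?addr_gt0 // lerDr ltW.
by rewrite mulrDl; lra.
Qed.

End FinalBounds.

(** * The recursion in expectation and the final rates *)

(** The averaged one-epoch bound holds for every possible past state; averaging it over the past
    gives a recursion between real numbers. *)
Lemma expected_recursion (R : realType) (n m p : nat) (n0 : (0 < n)%N) (m0 : (0 < m)%N)
    (f : 'I_n -> 'I_m -> 'rV[R]_p -> R) (L : R) (L0 : 0 < L)
    (fs : forall i l, smooth L (f i l)) (fb : forall i l, has_lbound (range (f i l)))
    (W : 'M[R]_n) (aW : admissible_mixing W)
    (d : measure_display) (Omega : measurableType d) (P : probability Omega R)
    (pi : nat -> 'I_n -> Omega -> 'S_m) (hpi : random_reshuffling P pi)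
    (x0 : 'M[R]_(n, p)) (alpha : R) (alpha0 : 0 < alpha) :
  let x := fun (t : nat) (w : Omega) =>
    drr f W alpha x0 (fun s i => pi s i w) t in
  let c := growth_rate m L W alpha in
  224 * (alpha * L * m%:R) ^+ 2 <= (1 - mixing_rate W ^+ 2) ^+ 2 ->
  exists q g : nat -> R,
  [/\ forall t, ('E_P[fun w => (frobenius_norm (gradient (objective f)
                               (agent_mean (x t w))) ^+ 2)%R] = (g t)%:E)%E,
      q 0%N = potential f L W alpha x0,
      forall t, 0 <= q t,
      forall t, 0 <= g t &
      forall t, q t.+1 <= (1 + c) * q t - alpha * m%:R / 4 * g t + c * sigma_star f].
Proof.
move=> x c small.
pose h (y : 'M[R]_(n, p)) := frobenius_norm (gradient (objective f) (agent_mean y)) ^+ 2.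
exists (fun t => fine 'E_P[fun w => potential f L W alpha (x t w)]%E).
exists (fun t => fine 'E_P[fun w => h (x t w)]%E).
have rep t := epoch_expectation hpi f W alpha x0 t.
split=> [t||t|t|t].
- by have [A [X [c0 [_ _ E _]]]] := rep t; rewrite (E h).
- by rewrite /x /= expectation_cst.
- have [A [X [c0 [c00 _ E _]]]] := rep t; rewrite E /= mulr_ge0 // sumr_ge0 // => a _.
  by rewrite mulr_ge0 // potential_ge0.
- have [A [X [c0 [c00 _ E _]]]] := rep t; rewrite (E h) /= mulr_ge0 // sumr_ge0 // => a _.
  by rewrite mulr_ge0 // sqr_ge0.
have [A [X [c0 [c00 c1 E ES]]]] := rep t; rewrite ES (E h) E /=.
pose B : R := #|{ffun 'I_n -> 'S_m}|%:R.
have step a := potential_average n0 m0 L0 fs fb aW alpha0 (X a) small.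
apply: le_trans (ler_wpM2l c00 (ler_sum _ (fun a _ => step a))) _.
(* The two sides are now equal, since the weights sum to one. *)
rewrite le_eqVlt; apply/predU1P; left.
rewrite (eq_bigr (fun a => (1 + c) * (B * potential f L W alpha (X a))
    - alpha * m%:R / 4 * (B * h (X a)) + B * (c * sigma_star f))); last first.
  by move=> a _; rewrite /h frobenius_norm_sqr -/c -/B; ring.
have cst (y : R) : \sum_(a : A) y = #|A|%:R * y by rewrite sumr_const mulr_natl.
rewrite big_split sumrB /= cst -(mulr_sumr _ _ _ (1 + c)).
rewrite -(mulr_sumr _ _ _ (alpha * m%:R / 4)) mulrDr mulrBr.
have -> : c0 * (#|A|%:R * (B * (c * sigma_star f))) = c0 * #|A|%:R * B * (c * sigma_star f) by ring.
by rewrite c1 mul1r !(mulrCA c0).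
Qed.

Theorem theorem2 (R : realType) (n m p : nat) (hn : (0 < n)%N) (hm : (0 < m)%N)
    (f : 'I_n -> 'I_m -> 'rV[R]_p -> R) (L : R) (hL : 0 < L)
    (hsmooth : forall i l, smooth L (f i l))
    (hbounded : forall i l, has_lbound (range (f i l)))
    (W : 'M[R]_n) (hW : admissible_mixing W)
    (d : measure_display) (Omega : measurableType d) (P : probability Omega R)
    (pi : nat -> 'I_n -> Omega -> 'S_m) (hpi : random_reshuffling P pi)
    (x0 : 'M[R]_(n, p)) (T : nat) (hT : (0 < T)%N)
    (alpha : R) (halpha : 0 < alpha) :
  let lambda := mixing_rate W in
  let F := objective f in
  let gap := F (agent_mean x0) - inf_value F in
  let x := fun (t : nat) (w : Omega) =>
    drr f W alpha x0 (fun s i => pi s i w) t in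
  let grad_sq := fun (t : nat) (w : Omega) =>
    frobenius_norm (gradient F (agent_mean (x t w))) ^+ 2 in
  let min_grad := (\big[Order.min/+oo]_(t < T) 'E_P[grad_sq t])%E in
  alpha <= Num.min ((1 - lambda ^+ 2) / (4 * m%:R * L * Num.sqrt 14))
                   (((1 - lambda ^+ 2) ^+ 2
                     / (384 * m%:R ^+ 2 * L ^+ 3 * T%:R)) `^ (1 / 3)) ->
  (min_grad <=
     (12 * gap / (alpha * m%:R * T%:R)
      + 96 * L ^+ 2 * frobenius_norm (consensus_error x0) ^+ 2
        / (m%:R * n%:R * (1 - lambda ^+ 2) * T%:R)
      + 984 * alpha ^+ 2 * m%:R * L ^+ 3 * sigma_star f
        / (1 - lambda ^+ 2) ^+ 2)%:E)%E
  /\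
  (alpha = (4 * Num.sqrt 14 * m%:R * L / (1 - lambda ^+ 2)
            + (384 * m%:R ^+ 2 * L ^+ 3 * T%:R
               / (1 - lambda ^+ 2) ^+ 2) `^ (1 / 3))^-1 ->
   (min_grad <=
      ((88 * L * gap + 20 * L * sigma_star f)
         / ((1 - lambda ^+ 2) `^ (2 / 3) * m%:R `^ (1 / 3) * T%:R `^ (2 / 3))
       + 96 * L ^+ 2 * frobenius_norm (consensus_error x0) ^+ 2
         / (m%:R * n%:R * (1 - lambda ^+ 2) * T%:R)
       + 48 * Num.sqrt 14 * L * gap / ((1 - lambda ^+ 2) * T%:R))%:E)%E).
Proof.
move=> lambda F gap x grad_sq min_grad; rewrite le_min => /andP[step1 step2].
have /andP[r0 r1] := mixing_rate_sqr_ge0_lt1 hW; rewrite -/lambda in r0 r1.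
set e := 1 - lambda ^+ 2 in step1 step2 *.
have e0 : 0 < e by rewrite subr_gt0.
have m0 : 0 < m%:R :> R by rewrite ltr0n.
have n0 : 0 < n%:R :> R by rewrite ltr0n.
have T0 : 0 < T%:R :> R by rewrite ltr0n.
have gap0 : 0 <= gap by rewrite subr_ge0 inf_objective_le.
have s0 : 0 <= sigma_star f by exact: sigma_star_ge0.
have small := step_sqr_le m0 e0 hL halpha step1.
have cube := step_cube_le m0 T0 hL halpha step2.
have [q [g [Eg q0 qge0 gge0 rec]]] :=
  expected_recursion hn hm hL hsmooth hbounded hW hpi x0 halpha small.
set c := growth_rate m L W alpha in rec.
have c0 : 0 <= c by exact: growth_rate_ge0.
have cE : c = 24 * (alpha ^+ 3 * L ^+ 3 * m%:R ^+ 2) / e ^+ 2.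
  by rewrite /c /growth_rate -/lambda -/e; ring.
(* The cubic stepsize condition gives [24 / 384 = 1 / 16], well within the required bound. *)
have cT : c * T%:R <= 1 / 2.
  rewrite cE mulrAC ler_pdivrMr ?exprn_gt0 //.
  have := sqr_ge0 e; lra.
pose t0 := [arg min_(i < Ordinal hT) g i]%O.
have t0min (t : nat) : (t < T)%N -> g t0 <= g t.
  by move=> tT; rewrite /t0; case: arg_minP => // i _ /(_ (Ordinal tT) isT).
have min_le : (min_grad <= (g t0)%:E)%E by rewrite -Eg; exact: bigmin_le.
have b0 : 0 < alpha * m%:R / 4 by rewrite !mulr_gt0.
have main := descent_recursion (ltW b0) c0 s0 (gge0 t0) cT (qge0 0%N) (qge0 T)
  (fun t _ => rec t) t0min.
set bound := 12 * gap / _ + _ + _.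
have first : (min_grad <= bound%:E)%E.
  apply: le_trans min_le _; rewrite lee_fin.
  (* Undoes the factor [b * T] of the telescoped bound, where [b = alpha * m / 4]. *)
  have -> : g t0 = alpha * m%:R / 4 * T%:R * g t0 * (4 / (alpha * m%:R * T%:R)).
    by field; rewrite !gt_eqF.
  have w0 : 0 <= 4 / (alpha * m%:R * T%:R) by rewrite divr_ge0 // !mulr_ge0 // ltW.
  apply: le_trans (ler_wpM2r w0 main) _.
  rewrite q0 /potential -/F -/gap -frobenius_norm_sqr; set N := frobenius_norm _ ^+ 2.
  (* The constants obtained, 8, 16 and 192, lie below the claimed 12, 96 and 984. *)
  have -> : 2 * (gap + 2 * alpha * L ^+ 2 / (1 - mixing_rate W ^+ 2)
       * (n%:R^-1 * N) + c * T%:R * sigma_star f)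
       * (4 / (alpha * m%:R * T%:R)) =
     8 * (gap / (alpha * m%:R * T%:R))
     + 16 * (L ^+ 2 * N / (m%:R * n%:R * e * T%:R))
     + 192 * (alpha ^+ 2 * m%:R * L ^+ 3 * sigma_star f / e ^+ 2).
    by rewrite cE -/lambda -/e; field; rewrite !gt_eqF.
  have p1 : 0 <= gap / (alpha * m%:R * T%:R) by rewrite divr_ge0 // !mulr_ge0 // ltW.
  have p2 : 0 <= L ^+ 2 * N / (m%:R * n%:R * e * T%:R).
    by apply: divr_ge0; [rewrite mulr_ge0 ?sqr_ge0 | rewrite !mulr_ge0 // ltW].
  have p3 : 0 <= alpha ^+ 2 * m%:R * L ^+ 3 * sigma_star f / e ^+ 2.
    by rewrite divr_ge0 ?sqr_ge0 // !mulr_ge0 ?exprn_ge0 // ltW.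
  by rewrite /bound -/N; lra.
split=> // alphaE; apply: le_trans first _; rewrite lee_fin.
exact: explicit_step_le.
Qed.
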